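(* Let $(M,L)$ and $(M,\widetilde L)$ be conformally related Finsler manifolds. Then $(M,L)$ is quasi-$C$-reducible if and only if $(M,\widetilde{L})$ is quasi-$C$-reducible.
   Context: $M$ is a real paracompact $C^\infty$ manifold of finite dimension $n$; all objects are $C^\infty$. $\pi:\mathcal{T}M\to M$ is the bundle of nonzero tangent vectors, $\pi^{-1}(TM)$ the pullback of $TM$ by $\pi$. Sections of $\pi^{-1}(TM)$ are called $\pi$-vector fields; $\pi$-forms are forms (covariant tensor fields) on $\pi^{-1}(TM)$; $\overline\eta(u)=(u,u)$. $\rho:T(\mathcal{T}M)\to\pi^{-1}(TM)$ is $\rho=(\pi_{\mathcal{T}M},d\pi)$ and $\gamma:\pi^{-1}(TM)\to T(\mathcal{T}M)$ is the vertical lift. For a linear connection $D$ on $\pi^{-1}(TM)$, $K(X):=D_X\overline\eta$; $D$ is regular if $T(\mathcal{T}M)=V(\mathcal{T}M)\oplus H(\mathcal{T}M)$ with $H=\ker K$, $V$ the vertical bundle, and then $\beta:=(\rho|_{H})^{-1}$. Torsion: $\mathbf{T}(X,Y)=D_X\rho Y-D_Y\rho X-\rho[X,Y]$, $Q(\overline X,\overline Y)=\mathbf{T}(\beta\overline X,\beta\overline Y)$, $T(\overline X,\overline Y)=\mathbf{T}(\gamma\overline X,\beta\overline Y)$. $(M,L)$ is a Finsler manifold with Finsler metric $g$ on $\pi^{-1}(TM)$. The Cartan connection $\nabla$ is the unique regular connection with $\nabla g=0$, $Q=0$ and $g(T(\overline X,\overline Y),\overline Z)=g(T(\overline X,\overline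 Z),\overline Y)$; $T$ is its (h)hv-torsion. Cartan tensor: $T(\overline X,\overline Y,\overline Z):=g(T(\overline X,\overline Y),\overline Z)$. Contracted torsion: $C(\overline X):=\mathrm{Tr}\{\overline Y\mapsto T(\overline X,\overline Y)\}$. $(M,L)$, with $\dim M\ge3$, is quasi-$C$-reducible if $T(\overline X,\overline Y,\overline Z)=A(\overline X,\overline Y)C(\overline Z)+A(\overline Y,\overline Z)C(\overline X)+A(\overline Z,\overline X)C(\overline Y)$ for some symmetric $\pi$-form $A$ of order two that is indicatory, i.e. $A(\overline X,\overline\eta)=0$ for all $\overline X$. $(M,L)$ and $(M,\widetilde L)$ are conformally related if $\widetilde g=e^{2\sigma(x)}g$ for a positive differentiable function $\sigma$ on $M$. *)

(* Defs.v *)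
From HB Require Import structures.
From mathcomp Require Import all_boot all_order all_algebra.
From mathcomp Require Import all_classical all_reals all_analysis.

Set Implicit Arguments.
Unset Strict Implicit.
Unset Printing Implicit Defensive.

Import Order.TTheory GRing.Theory Num.Theory.
Import numFieldNormedType.Exports.

Local Open Scope classical_set_scope.
Local Open Scope ring_scope.

Fixpoint Ck (R : realType) (V W : normedModType R) (k : nat)
    (f : V -> W) (U : set V) : Prop :=
  match k with
  | 0 => forall x, U x -> {for x, continuous f}
  | k'.+1 => (forall x, U x -> differentiable f x) /\
             forall v, Ck k' (fun x => 'D_v f x) U
  end.

Definition smooth_on (R : realType) (V W : normedModType R)
    (f : V -> W) (U : set V) : Prop := forall k, Ck k f U.

(* [atlas M E] is only the data of a family of E-valued charts on M; the axioms
   of a manifold are in [manifold] below.  Smooth functions, tangent spaces and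
   Lie brackets make sense for the bare data, so the same definitions serve for
   M and for the bundle TM of nonzero tangent vectors with its induced charts.
   The value of a chart map outside its domain is irrelevant. *)

Record atlas (M : Type) (E : Type) := Atlas {
  chart : Type;
  cdom : chart -> set M;
  cmap : chart -> M -> E }.

Definition cimage (M E : Type) (A : atlas M E) (i : chart A) : set E :=
  cmap i @` cdom i.

Section Charts.
Context {R : realType} {E : normedModType R} {M : Type} (A : atlas M E).

(* f \o (cmap i)^-1, extended by 0 outside the image of the chart *)
Definition loc (W : nmodType) (i : chart A) (f : M -> W) (x : E) : W :=
  match pselect (exists p, cdom i p /\ cmap i p = x) with
  | left h => f (projT1 (cid h))
  | right _ => 0
  end.

Definition some_chart (p : M) : option (chart A) :=
  match pselect (exists i : chart A, cdom i p) with
  | left h => Some (projT1 (cid h))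
  | right _ => None
  end.

Definition smooth_near (W : normedModType R) (f : M -> W) (p : M) : Prop :=
  forall i : chart A, cdom i p -> exists U : set E,
    [/\ open U, U (cmap i p), U `<=` cimage i & smooth_on (loc i f) U].

Definition smooth (W : normedModType R) (f : M -> W) : Prop :=
  forall p, smooth_near f p.

(* A tangent vector at p is the family of its components in all the charts at p
   (0 in the other charts), components in two charts being related by the
   differential of the change of coordinates. *)
Definition is_tangent (p : M) (v : chart A -> E) : Prop :=
  (forall i, ~ cdom i p -> v i = 0) /\
  (forall i j, cdom i p -> cdom j p ->
     v j = 'd (loc i (cmap j)) (cmap i p) (v i)).

Definition tangent_pred (p : M) : {pred (chart A -> E)} :=
  fun v => `[< is_tangent p v >].

Lemma tangent_submod (p : M) : submod_closed (tangent_pred p).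
Proof.
split.
  by apply/asboolP; split=> [//|i j _ _]; rewrite linear0.
move=> a v w /asboolP[v0 vE] /asboolP[w0 wE]; apply/asboolP; split=> [i ip|i j ip jp].
  by rewrite !fctE (v0 _ ip) (w0 _ ip) scaler0 addr0.
by rewrite !fctE linearP -vE // -wE.
Qed.

HB.instance Definition _ (p : M) :=
  GRing.isSubmodClosed.Build R (chart A -> E) (tangent_pred p)
    (tangent_submod p).

Record tangent (p : M) := Tangent {
  tcoord :> chart A -> E;
  _ : tcoord \in tangent_pred p }.

HB.instance Definition _ (p : M) := [isSub for @tcoord p].
HB.instance Definition _ (p : M) := [Choice of tangent p by <:].
HB.instance Definition _ (p : M) :=
  [SubChoice_isSubLmodule of tangent p by <:].

(* The tangent vector with the given components.  The default value 0 is never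
   used for families satisfying [is_tangent], which is the case of all the
   families below on a manifold. *)
Definition mk_tangent (p : M) (v : chart A -> E) : tangent p :=
  insubd (0 : tangent p) v.

(* The derivative X . f; it does not depend on the chart. *)
Definition tder (p : M) (X : tangent p) (W : normedModType R) (f : M -> W) : W :=
  if some_chart p is Some i then 'd (loc i f) (cmap i p) (X i) else 0.

Definition vfield := forall p : M, tangent p.

Definition smooth_vfield_near (X : vfield) (p : M) : Prop :=
  forall i : chart A, cdom i p -> smooth_near (fun q => X q i) p.

(* [X, Y]^k = X . Y^k - Y . X^k in every chart *)
Definition lie_bracket (X Y : vfield) : vfield := fun p =>
  mk_tangent p (fun i =>
    if `[< cdom i p >]
    then tder (X p) (fun q => Y q i) - tder (Y p) (fun q => X q i) else 0).

(* The tangent vector at p whose components in the chart i are e *)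
Definition coord_vector (i : chart A) (e : E) (p : M) : tangent p :=
  mk_tangent p (fun j =>
    if `[< cdom i p /\ cdom j p >]
    then 'd (loc i (cmap j)) (cmap i p) e else 0).

End Charts.

Arguments mk_tangent {R E M} A p v.
Arguments vfield {R E M} A.

Definition pushforward (R : realType) (E F : normedModType R) (M N : Type)
    (A : atlas M E) (B : atlas N F) (f : M -> N) (p : M) (X : tangent A p) :
    tangent B (f p) :=
  mk_tangent B (f p) (fun j =>
    if `[< cdom j (f p) >] then tder X (fun q => cmap j (f q)) else 0).

Definition open_cover (M : topologicalType) (C : set (set M)) : Prop :=
  (forall U, C U -> open U) /\ \bigcup_(U in C) U = setT.

Definition paracompact (M : topologicalType) : Prop :=
  forall C : set (set M), open_cover C ->
  exists D : set (set M),
    [/\ open_cover D,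
        (forall V, D V -> exists2 U, C U & V `<=` U) &
        forall p : M, exists2 N, nbhs p N &
          finite_set [set V | D V /\ V `&` N !=set0]].

(* Every chart is a homeomorphism from an open set of M onto an open set of
   R^n, and the changes of coordinates are C^oo. *)
Definition manifold (R : realType) (n : nat) (M : topologicalType)
    (A : atlas M 'rV[R]_n) : Prop :=
  hausdorff_space M /\ paracompact M /\
  (forall p, exists i : chart A, cdom i p) /\
  (forall i : chart A,
     [/\ open (cdom i),
         {in cdom i &, injective (cmap i)},
         (forall p, cdom i p -> {for p, continuous (cmap i)}) &
         forall U, open U -> U `<=` cdom i -> open (cmap i @` U)]) /\
  (forall i j : chart A,
     smooth_on (loc i (cmap j)) (cmap i @` (cdom i `&` cdom j))).

Section Pullback.
Context {R : realType} {n : nat} {M : Type} (A : atlas M 'rV[R]_n).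
Local Notation E := 'rV[R]_n.

Record slit := Slit {
  foot : M;
  fib : tangent A foot;
  fib_neq0 : fib != 0 }.

(* The induced charts (x, y) of the slit tangent bundle *)
Definition slit_atlas : atlas slit (E * E)%type :=
  @Atlas slit (E * E)%type (chart A)
    (fun i u => cdom i (foot u))
    (fun i u => (cmap i (foot u), fib u i)).

Local Notation Tslit u := (tangent slit_atlas u).
Local Notation pi_fiber u := (tangent A (foot u)).

Definition pi_field := forall u : slit, pi_fiber u.

Definition smooth_pi_near (s : pi_field) (u : slit) : Prop :=
  forall i : chart A, cdom i (foot u) ->
    smooth_near slit_atlas (fun w => s w i) u.

Definition eta : pi_field := fun u => fib u.

(* Second component of rho = (pi_TM, d pi) *)
Definition rho (u : slit) (X : Tslit u) : pi_fiber u :=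
  pushforward A foot X.

(* The vertical lift: the velocity at t = 0 of t |-> u + t v, whose components
   in the induced chart i are (0, v^i). *)
Definition gamma (u : slit) (v : pi_fiber u) : Tslit u :=
  mk_tangent slit_atlas u (fun i => (0, v i)).

(* Trace at u of an endomorphism of the module of pi-vector fields, computed in
   the frame d/dx^k of any chart around u. *)
Definition pi_trace (F : pi_field -> pi_field) (u : slit) : R :=
  if some_chart A (foot u) is Some i then
    \sum_(k < n)
      (F (fun w => coord_vector i (delta_mx 0 k) (foot w)) u i) 0 k
  else 0.

(* A connection is given by its action D_X s in the direction of X in
   T_u(TM) on sections s defined and smooth near u.  A section that is only
   smooth near u is represented by an arbitrary extension; that the value at u
   depends only on the germ of s follows from the axioms. *)

Definition pi_derivation := forall u : slit, Tslit u -> pi_field -> pi_fiber u.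

Definition linear_connection (D : pi_derivation) : Prop :=
  (forall u (a : R) (X Y : Tslit u) s, smooth_pi_near s u ->
     D u (a *: X + Y) s = a *: D u X s + D u Y s) /\
  (forall u (X : Tslit u) s t, smooth_pi_near s u -> smooth_pi_near t u ->
     D u X (fun w => s w + t w) = D u X s + D u X t) /\
  (forall u (X : Tslit u) (f : slit -> R^o) s,
     smooth_near slit_atlas f u -> smooth_pi_near s u ->
     D u X (fun w => f w *: s w) = tder X f *: s u + f u *: D u X s) /\
  (forall u (X : vfield slit_atlas) s,
     smooth_vfield_near X u -> smooth_pi_near s u ->
     smooth_pi_near (fun w => D w (X w) s) u).

Section Connection.
Variable D : pi_derivation.

Definition Kmap (u : slit) (X : Tslit u) : pi_fiber u := D X eta.

(* T(TM) = V (+) H with V = ker (d pi) and H = ker K *)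
Definition regular_connection : Prop :=
  linear_connection D /\
  forall u : slit,
    (forall Z : Tslit u, exists X Y : Tslit u,
       [/\ rho X = 0, Kmap Y = 0 & Z = X + Y]) /\
    (forall Z : Tslit u, rho Z = 0 -> Kmap Z = 0 -> Z = 0).

(* beta = (rho|H)^-1 *)
Definition beta (u : slit) (v : pi_fiber u) : Tslit u :=
  xget 0 [set X : Tslit u | Kmap X = 0 /\ rho X = v].

Definition torsion (X Y : vfield slit_atlas) : pi_field := fun u =>
  D (X u) (fun w => rho (Y w)) - D (Y u) (fun w => rho (X w))
  - rho (lie_bracket X Y u).

Definition horizontal_torsion (X Y : pi_field) : pi_field :=
  torsion (fun w => beta (X w)) (fun w => beta (Y w)).

Definition mixed_torsion (X Y : pi_field) : pi_field :=
  torsion (fun w => gamma (X w)) (fun w => beta (Y w)).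

Definition contracted_torsion (X : pi_field) : slit -> R :=
  pi_trace (mixed_torsion X).

End Connection.

(* g_u(v, w) = 1/2 d^2/ds dt L^2(u + s v + t w) at s = t = 0 *)
Definition finsler_metric (L : forall p, tangent A p -> R)
    (u : slit) (v w : pi_fiber u) : R :=
  2^-1 * derive1 (fun s : R =>
    derive1 (fun t : R =>
      L (foot u) (fib u + s *: v + t *: w) ^+ 2 : R^o) 0 : R^o) 0.

Definition finsler (L : forall p, tangent A p -> R) : Prop :=
  smooth slit_atlas (fun u => L (foot u) (fib u) : R^o) /\
  (forall p (v : tangent A p), v != 0 -> 0 < L p v) /\
  (forall p (v : tangent A p) (a : R), 0 <= a -> L p (a *: v) = a * L p v) /\
  (forall u (v : pi_fiber u), v != 0 -> 0 < finsler_metric L v v).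

Definition cartan_tensor (L : forall p, tangent A p -> R) (D : pi_derivation)
    (X Y Z : pi_field) (u : slit) : R :=
  finsler_metric L (mixed_torsion D X Y u) (Z u).

Definition cartan_connection (L : forall p, tangent A p -> R)
    (D : pi_derivation) : Prop :=
  regular_connection D /\
  (forall u (X : Tslit u) (Y Z : pi_field),
     smooth_pi_near Y u -> smooth_pi_near Z u ->
     tder X (fun w => finsler_metric L (Y w) (Z w) : R^o) =
     finsler_metric L (D u X Y) (Z u) + finsler_metric L (Y u) (D u X Z)) /\
  (forall u (X Y : pi_field), smooth_pi_near X u -> smooth_pi_near Y u ->
     horizontal_torsion D X Y u = 0) /\
  (forall u (X Y Z : pi_field), smooth_pi_near X u -> smooth_pi_near Y u ->
     smooth_pi_near Z u ->
     finsler_metric L (mixed_torsion D X Y u) (Z u) =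
     finsler_metric L (mixed_torsion D X Z u) (Y u)).

Definition symmetric_pi_form (B : forall u : slit, pi_fiber u -> pi_fiber u -> R) :
    Prop :=
  (forall u (a : R) (v v' w : pi_fiber u),
     B u (a *: v + v') w = a * B u v w + B u v' w) /\
  (forall u (v w : pi_fiber u), B u v w = B u w v) /\
  (forall u (X Y : pi_field), smooth_pi_near X u -> smooth_pi_near Y u ->
     smooth_near slit_atlas (fun w => B w (X w) (Y w) : R^o) u).

Definition indicatory (B : forall u : slit, pi_fiber u -> pi_fiber u -> R) : Prop :=
  forall u (v : pi_fiber u), B u v (eta u) = 0.

(* D is meant to be the Cartan connection of (M, L). *)
Definition quasi_C_reducible (L : forall p, tangent A p -> R)
    (D : pi_derivation) : Prop :=
  (3 <= n)%N /\
  exists B : forall u : slit, pi_fiber u -> pi_fiber u -> R,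
    [/\ symmetric_pi_form B, indicatory B &
      forall u (X Y Z : pi_field), smooth_pi_near X u -> smooth_pi_near Y u ->
        smooth_pi_near Z u ->
        cartan_tensor L D X Y Z u =
          B u (X u) (Y u) * contracted_torsion D Z u +
          B u (Y u) (Z u) * contracted_torsion D X u +
          B u (Z u) (X u) * contracted_torsion D Y u].

Definition conformally_related (L L' : forall p, tangent A p -> R) : Prop :=
  exists sigma : M -> R^o,
    [/\ smooth A sigma, (forall p, 0 < sigma p) &
      forall u (v w : pi_fiber u),
        finsler_metric L' v w =
        expR (2 * sigma (foot u)) * finsler_metric L v w].

End Pullback.

(* Main.v *)
(** The geometric content is that the (h)hv-torsion is a conformal invariant.
    For a Cartan connection D, T(X, Y) is D_{gamma X} Y minus the vertical
    derivative rho [gamma X, beta Y] of the components of Y, and the latter does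
    not depend on D.  So the two torsions T, T' differ by the endomorphism
    phi Y = D'_{gamma X} Y - D_{gamma X} Y.  The conformal factor is killed by
    vertical vectors, so that both connections are metric for g in the direction
    gamma X, which makes phi skew: g(phi Y, Z) + g(Y, phi Z) = 0.  The last axiom
    of the Cartan connection makes it symmetric: g(phi Y, Z) = g(phi Z, Y).
    Taking Z = phi Y, the two together give 2 g(phi Y, phi Y) = 0, hence phi = 0.
    Therefore T' = T and C' = C, and e^(2 sigma) A is the form required for g'. *)

Require Import Defs.
From HB Require Import structures.
From mathcomp Require Import all_boot all_order all_algebra.
From mathcomp Require Import perm.
From mathcomp Require Import all_classical all_reals all_analysis.
(* MathComp-Analysis has constants named eta, beta and gamma, hence the second import. *)
Require Import Defs.

Set Implicit Arguments.
Unset Strict Implicit.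
Unset Printing Implicit Defensive.

Import Order.TTheory GRing.Theory Num.Theory.
Import numFieldNormedType.Exports.

Local Open Scope classical_set_scope.
Local Open Scope ring_scope.

(** * Differentials and smooth maps *)

(** The weight of the proof lies in the term rho [gamma X, beta Y]. In an induced chart gamma X =
    (0, X) and beta Y = (Y, b), and rho keeps the first component; the component b, the only place
    where D enters, drops out. However, [lie_bracket] goes through [mk_tangent], whose value is 0 on
    a family that does not transform as a tangent vector. The chart formula for the bracket
    therefore requires that both fields be differentiable and that the second derivatives of the
    transition maps commute in the two directions concerned. Differentiability is a real issue for
    [beta], which picks a horizontal vector by choice: in a chart it solves a linear system whose
    vertical block is invertible by regularity, and Cramer's rule does the rest. The substitution Z
    = phi Y also needs care: the axioms speak of fields smooth near u, whereas phi Y is a single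
    vector at u, to be extended with constant components in a chart. The comparison is made for an
    arbitrary nowhere zero smooth factor c on M, so that the factors e^(2 sigma) and e^(-2 sigma)
    give the two implications. *)

Section Differential.
Context {R : realType}.
Implicit Types V W : normedModType R.

(** The difference [g - f] vanishes near [x], so its differential there is the zero map, and [g] is
    the sum of [f] and this difference. *)
Lemma near_eq_differentiable V W (f g : V -> W) (x : V) :
  (\near x, f x = g x) -> differentiable f x -> differentiable g x.
Proof.
move=> fg df.
have d0 : continuous (\0 : V -> W) /\
    ((g - f) \o shift x = cst ((g - f) x) + (\0 : V -> W) +o_ 0 id).
  split; first exact: cst_continuous.
  apply/eqaddoP => _/posnumP[e]; near=> h.
  rewrite /= !fctE /= (_ : g x - f x = 0); last by rewrite (nbhs_singleton fg) subrr.
  rewrite addr0 subr0 (_ : f (h + x) = g (h + x)) ?subrr ?normr0 ?mulr_ge0//.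
  near: h.
  by move: fg; rewrite (near_shift 0) /= subr0.
have d0E : 'd (g - f) x = \0 :> (V -> W) by apply: diff_unique; have [] := d0.
rewrite -(subrK f g); apply: differentiableD => //.
by apply/diff_locallyP; rewrite d0E.
Unshelve. all: by end_near. Qed.

(** The differential is selected by [xget] with the zero map as default value; a selected witness
    would make [f] differentiable. *)
Lemma diff_not_differentiable V W (f : V -> W) (x : V) :
  ~ differentiable f x -> 'd f x = \0 :> (V -> W).
Proof.
move=> ndh; rewrite /diff; case: xgetP => [l _ [lc lE]|_]; last by [].
case: ndh; apply/diffP => /=.
apply: (@getPex _ (fun (df : {linear V -> W}) => continuous df /\
  forall y, f y = f (lim (nbhs x)) + df (y - lim (nbhs x))
                +o_(y \near x) (y - lim (nbhs x)))).
by exists l.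
Qed.

(** If one of the maps is not differentiable at [x], neither is the other, and both differentials
    take the default value 0. *)
Lemma near_eq_diff V W (f g : V -> W) (x : V) :
  (\near x, f x = g x) -> 'd f x = 'd g x :> (V -> W).
Proof.
move=> fg; have gf : \near x, g x = f x by apply: filterS fg.
have [df|ndf] := pselect (differentiable f x); last first.
  rewrite !diff_not_differentiable // => dg.
  by apply: ndf; apply: near_eq_differentiable dg.
have dg := near_eq_differentiable fg df.
by apply/funext => v; rewrite -!deriveE //; apply: near_eq_derive.
Qed.

(** Leibniz rule, as the chain rule for the continuous bilinear map (a, w) |-> a w composed with the
    pair (f, g). *)
Lemma differentiable_scale V W (f : V -> R^o) (g : V -> W) (x : V) :
  differentiable f x -> differentiable g x ->
  differentiable (fun y => (f y : R) *: g y) x /\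
  forall v, 'd (fun y => (f y : R) *: g y) x v =
    (f x : R) *: 'd g x v + ('d f x v : R) *: g x.
Proof.
move=> df dg.
have bil : bilinear_for
    (GRing.Scale.Law.clone _ _ *:%R _) (GRing.Scale.Law.clone _ _ *:%R _)
    (fun (a : R^o) (w : W) => a *: w).
  by split => [w|a] k u v /=; rewrite ?scalerDl ?scalerDr !scalerA // mulrC.
pose bL := bilinear_isBilinear.Build R R^o W W _ _ _ bil.
pose b : {bilinear R^o -> W -> W} := HB.pack (fun (a : R^o) (w : W) => a *: w) bL.
have bc : continuous (fun p : R^o * W => b p.1 p.2).
  by move=> p; apply: (@scale_continuous _ _ p).
have dp : differentiable (fun y => (f y, g y)) x by apply: differentiable_pair.
have db := @differentiable_bilin _ _ _ _ b (f x, g x) bc.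
split; first exact: (differentiable_comp dp db).
move=> v.
rewrite [LHS](congr1 (@^~ v) (diff_comp dp db)) /=.
rewrite [LHS](congr1 (@^~ _) (diff_bilin (f x, g x) bc)) /= diff_pair //=.
Qed.

End Differential.

(** * Calculus of C^k maps on open sets *)

Section SmoothCalculus.
Context {R : realType}.
Implicit Types V W : normedModType R.

Lemma Ck_ext V W k (f g : V -> W) (U : set V) : open U ->
  (forall x, U x -> f x = g x) -> Ck k f U -> Ck k g U.
Proof.
move=> oU; elim: k f g => [|k IH] f g fg /=.
  move=> cf x Ux; rewrite /prop_for /continuous_at -fg //.
  apply: cvg_trans (cf x Ux); apply: near_eq_cvg.
  by apply: filterS (open_nbhs_nbhs (conj oU Ux)) => y /fg.
have near_fg x : U x -> \near x, f x = g x.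
  by move=> Ux; apply: filterS (open_nbhs_nbhs (conj oU Ux)) => y /fg.
move=> [df cf]; split=> [x Ux|v].
  exact: near_eq_differentiable (near_fg x Ux) (df x Ux).
by apply: IH (cf v) => x Ux; apply: near_eq_derive; apply: near_fg.
Qed.

Lemma Ck_sub V W k (f : V -> W) (U U' : set V) :
  U' `<=` U -> Ck k f U -> Ck k f U'.
Proof.
move=> UU; elim: k f => [|k IH] f /=; first by move=> cf x /UU/cf.
by move=> [df cf]; split=> [x /UU/df//|v]; apply: IH.
Qed.

Lemma Ck_pred V W k (f : V -> W) (U : set V) : Ck k.+1 f U -> Ck k f U.
Proof.
elim: k f => [|k IH] f; first by move=> [df _] x /df; apply: differentiable_continuous.
by move=> [df cf]; split=> // v; apply/IH/cf.
Qed.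

Lemma Ck_differentiable V W k (f : V -> W) (U : set V) x :
  Ck k.+1 f U -> U x -> differentiable f x.
Proof. by move=> [df _] /df. Qed.

Lemma Ck_cst V W k (a : W) (U : set V) : Ck k (fun=> a) U.
Proof.
elim: k a => [|k IH] a /=; first by move=> x _; exact: cst_continuous.
split=> [x _|v]; first exact: differentiable_cst.
have -> : (fun x => 'D_v (fun=> a) x) = (fun=> 0 : W); last exact: IH.
by apply/funext => x; apply: derive_cst.
Qed.

Section open_set.
Variables (V : normedModType R) (U : set V).
Hypothesis oU : open U.

Lemma Ck_add W k (f g : V -> W) :
  Ck k f U -> Ck k g U -> Ck k (fun x => f x + g x) U.
Proof.
elim: k f g => [|k IH] f g /=.
  by move=> cf cg x Ux; apply: continuousD; [exact: cf|exact: cg].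
move=> [df cf] [dg cg]; split=> [x Ux|v].
  by apply: differentiableD; [exact: df|exact: dg].
apply: Ck_ext (IH _ _ (cf v) (cg v)) => // x Ux.
by rewrite -deriveD //; apply: diff_derivable; [exact: df|exact: dg].
Qed.

Lemma Ck_sum W k m (f : 'I_m -> V -> W) :
  (forall i, Ck k (f i) U) -> Ck k (fun x => \sum_(i < m) f i x) U.
Proof.
move=> cf; elim: m f cf => [|m IH] f cf.
  have -> : (fun x => \sum_(i < 0) f i x) = (fun=> 0 : W); last exact: Ck_cst.
  by apply/funext => x; rewrite big_ord0.
have -> : (fun x => \sum_(i < m.+1) f i x) =
    (fun x => \sum_(i < m) f (widen_ord (leqnSn m) i) x + f ord_max x).
  by apply/funext => x; rewrite big_ord_recr.
by apply: Ck_add => //; apply: IH => i.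
Qed.

Lemma Ck_scale W k (f : V -> R^o) (g : V -> W) :
  Ck k f U -> Ck k g U -> Ck k (fun x => (f x : R) *: g x) U.
Proof.
elim: k f g => [|k IH] f g.
  by move=> cf cg x Ux; apply: (@continuousZ _ _ _ f g); [exact: cf|exact: cg].
move=> cf cg; have [df cf'] := cf; have [dg cg'] := cg; split=> [x Ux|v].
  by have [] := differentiable_scale (df x Ux) (dg x Ux).
(* In each Leibniz term one factor has been differentiated and the other has not; [Ck_pred] lowers
   the latter to order [k]. *)
have cfg := Ck_add (IH _ _ (Ck_pred cf) (cg' v)) (IH _ _ (cf' v) (Ck_pred cg)).
apply: Ck_ext cfg => // x Ux.
have [dfg E] := differentiable_scale (df x Ux) (dg x Ux).
by rewrite [RHS]deriveE // E -!deriveE; [rewrite ?addrA|exact: df|exact: dg].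
Qed.

Lemma Ck_linear_comp W W' k (l : {linear W -> W'}) (f : V -> W) :
  continuous l -> Ck k f U -> Ck k (fun x => l (f x)) U.
Proof.
move=> cl; elim: k f => [|k IH] f.
  by move=> cf x Ux; apply: continuous_comp; [exact: cf|exact: cl].
move=> [df cf]; have dl y : differentiable l y by exact: linear_differentiable.
split=> [x Ux|v]; first exact: differentiable_comp (df x Ux) (dl _).
apply: Ck_ext (IH _ (cf v)) => // x Ux.
rewrite [RHS]deriveE; last exact: differentiable_comp (df x Ux) (dl _).
by rewrite [RHS](congr1 (@^~ v) (diff_comp (df x Ux) (dl _))) /= diff_lin //
  deriveE //; exact: df.
Qed.

Lemma Ck_pair W W' k (f : V -> W) (g : V -> W') :
  Ck k f U -> Ck k g U -> Ck k (fun x => (f x, g x)) U.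
Proof.
elim: k f g => [|k IH] f g.
  by move=> cf cg x Ux; apply: cvg_pair; [exact: cf|exact: cg].
move=> [df cf] [dg cg]; split=> [x Ux|v].
  by apply: differentiable_pair; [exact: df|exact: dg].
apply: Ck_ext (IH _ _ (cf v) (cg v)) => // x Ux.
rewrite [RHS]deriveE; last by apply: differentiable_pair; [exact: df|exact: dg].
by rewrite diff_pair; [rewrite !deriveE //; [exact: dg|exact: df]|exact: df|exact: dg].
Qed.

Lemma Ck_id k : Ck k (@idfun V) U.
Proof.
case: k => [|k]; first by move=> x _; exact: cvg_id.
split=> [x _|v]; first exact: (@ex_diff _ _ _ _ _ _ _ (is_diff_id x)).
have -> : (fun x => 'D_v (@idfun V) x) = (fun=> v); last exact: Ck_cst.
by apply/funext => x; apply: derive_id.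
Qed.

End open_set.

(** A finite spanning family with continuous coordinate functionals. It serves to expand a
    differential along a variable direction into derivatives along the fixed directions [b i], the
    only ones that [Ck] controls. *)
Definition frame V (m : nat) (b : 'I_m -> V) (c : 'I_m -> {linear V -> R^o}) : Prop :=
  (forall i, continuous (c i)) /\
  (forall v, v = \sum_(i < m) (c i v : R) *: b i).

Definition finite_dim V := exists m b c, @frame V m b c.

(** By the chain rule the derivative of the composite is the derivative of [f] at [g x] along the
    moving direction ['D_v g x]. Expanded in a frame it becomes a sum of products of C^k functions,
    to which the induction applies. *)
Lemma Ck_comp V V' W k (f : V' -> W) (g : V -> V') (U : set V) (U' : set V') :
  finite_dim V' -> open U -> (forall x, U x -> U' (g x)) ->
  Ck k f U' -> Ck k g U -> Ck k (fun x => f (g x)) U.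
Proof.
move=> [m [b [c [cc bE]]]] oU gU; elim: k f => [|k IH] f.
  by move=> cf cg x Ux; apply: continuous_comp; [exact: cg|exact: cf (gU _ Ux)].
move=> [df cf] cg; have [dg cg'] := cg; split=> [x Ux|v].
  exact: differentiable_comp (dg x Ux) (df _ (gU x Ux)).
have : Ck k (fun x => \sum_(i < m) (c i ('D_v g x) : R) *: 'D_(b i) f (g x)) U.
  apply: Ck_sum => // i; apply: Ck_scale => //.
    exact: Ck_linear_comp (cg' v).
  exact: IH (cf (b i)) (Ck_pred cg).
apply: Ck_ext => // x Ux.
rewrite [RHS]deriveE; last exact: differentiable_comp (dg x Ux) (df _ (gU x Ux)).
rewrite [RHS](congr1 (@^~ v) (diff_comp (dg x Ux) (df _ (gU x Ux)))) /=.
rewrite -(@deriveE _ _ _ g) //; last exact: dg.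
rewrite [in RHS](bE ('D_v g x)) linear_sum; apply: eq_bigr => i _.
by rewrite linearZ /= (@deriveE _ _ _ f) //; exact: df (gU x Ux).
Qed.

Lemma finite_dim_real : finite_dim R^o.
Proof.
exists 1, (fun=> 1), (fun=> idfun : {linear R^o -> R^o}); split=> [i x|v].
  exact: cvg_id.
by rewrite big_ord1 [RHS]mulr1.
Qed.

Lemma finite_dim_rV n : finite_dim 'rV[R]_n.
Proof.
pose c (k : 'I_n) (v : 'rV[R]_n) : R^o := v 0 k.
have cl k : linear (c k) by move=> a u v; rewrite /c !mxE.
pose C k : {linear 'rV[R]_n -> R^o} :=
  HB.pack (c k) (GRing.isLinear.Build _ _ _ _ _ (cl k)).
exists n, (fun k => delta_mx 0 k), C; split=> [k|v].
  exact: coord_continuous.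
exact: row_sum_delta.
Qed.

Lemma pair_scaleE V W (a : R) (v : V) (w : W) :
  a *: (v, w) = (a *: v, a *: w) :> V * W.
Proof. by []. Qed.

Lemma pair_addE V W (v v' : V) (w w' : W) :
  (v, w) + (v', w') = (v + v', w + w') :> V * W.
Proof. by []. Qed.

Lemma finite_dim_pair V W : finite_dim V -> finite_dim W -> finite_dim (V * W)%type.
Proof.
move=> [m [b [c [cc bE]]]] [m' [b' [c' [cc' bE']]]].
pose bb (i : 'I_(m + m')) : V * W :=
  match fintype.split i with inl j => (b j, 0) | inr j => (0, b' j) end.
pose cb (i : 'I_(m + m')) (v : V * W) : R^o :=
  match fintype.split i with inl j => c j v.1 | inr j => c' j v.2 end.
have cl k : linear (cb k).
  by move=> a u v; rewrite /cb; case: fintype.split => j /=; rewrite linearP.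
pose C k : {linear (V * W)%type -> R^o} :=
  HB.pack (cb k) (GRing.isLinear.Build _ _ _ _ _ (cl k)).
exists (m + m')%N, bb, C; split=> [k|[v w]].
  rewrite /C /= /cb; case: fintype.split => j x.
    by apply: (@continuous_comp _ _ _ fst (c j)); [exact: cvg_fst|exact: cc].
  by apply: (@continuous_comp _ _ _ snd (c' j)); [exact: cvg_snd|exact: cc'].
rewrite big_split_ord /= /cb /bb.
rewrite (eq_bigr (fun i => (((c i v : R) *: b i), 0 : W))); last first.
  by move=> i _; rewrite (unsplitK (inl i : 'I_m + 'I_m')) pair_scaleE scaler0.
rewrite [X in _ + X](eq_bigr (fun i => (0 : V, ((c' i w : R) *: b' i)))); last first.
  by move=> i _; rewrite (unsplitK (inr i : 'I_m + 'I_m')) pair_scaleE scaler0.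
have E1 : \sum_(i < m) ((c i v : R) *: b i, 0 : W) = (v, 0).
  rewrite [in RHS](bE v); elim/big_ind2 : _ => // ? ? ? ? -> ->.
  by rewrite pair_addE addr0.
have E2 : \sum_(i < m') (0 : V, (c' i w : R) *: b' i) = (0, w).
  rewrite [in RHS](bE' w); elim/big_ind2 : _ => // ? ? ? ? -> ->.
  by rewrite pair_addE addr0.
by rewrite E1 E2 pair_addE addr0 add0r.
Qed.

Lemma Ck_expR k (U : set R^o) : open U -> Ck k (expR : R^o -> R^o) U.
Proof.
move=> oU; elim: k => [|k IH]; first by move=> x _; exact: continuous_expR.
have dE (x : R^o) : differentiable (expR : R^o -> R^o) x.
  by apply/derivable1_diffP; exact: derivable_expR.
split=> [x _|v]; first exact: dE.
apply: Ck_ext (Ck_scale oU IH (Ck_cst _ (v : R^o) U)) => // x Ux.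
rewrite deriveE // -[v in RHS]mulr1 -[v * 1]/(v *: 1) linearZ /=.
by rewrite -deriveE // [in RHS]derive_val [LHS]mulrC.
Qed.

End SmoothCalculus.

(** * Differentiating a differential along a moving direction *)

Section DifferentialOfDifferential.
Context {R : realType}.
Implicit Types V W Z : normedModType R.

Lemma Ck_near_deriveE V W k (f : V -> W) (U : set V) x v :
  open U -> U x -> Ck k.+1 f U -> \near x, 'd f x v = 'D_v f x.
Proof.
move=> oU Ux [df _]; apply: filterS (open_nbhs_nbhs (conj oU Ux)) => y Uy.
by rewrite deriveE //; exact: df.
Qed.

Lemma Ck_differentiable_diff V W (f : V -> W) (U : set V) x v :
  open U -> U x -> Ck 2 f U -> differentiable (fun y => 'd f y v) x.
Proof.
move=> oU Ux cf; have [_ cf'] := cf.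
have dfv : differentiable (fun y => 'D_v f y) x.
  by have [] := cf' v => + _; exact.
apply: near_eq_differentiable dfv.
by apply: filterS (Ck_near_deriveE v oU Ux cf) => y ->.
Qed.

Lemma diff_along V W Z (f : V -> W) (U : set V) (G Y : Z -> V) z :
  finite_dim V -> open U -> U (G z) -> Ck 2 f U ->
  differentiable G z -> differentiable Y z ->
  differentiable (fun z' => 'd f (G z') (Y z')) z /\
  forall v, 'd (fun z' => 'd f (G z') (Y z')) z v =
    'd (fun x => 'd f x (Y z)) (G z) ('d G z v) + 'd f (G z) ('d Y z v).
Proof.
move=> [m [b [c [cc bE]]]] oU UG cf dG dY.
have dc k y : differentiable (c k) y by exact: linear_differentiable.
have dfb k : differentiable (fun y => 'd f y (b k)) (G z).
  exact: Ck_differentiable_diff cf.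
have dY' k : differentiable (fun z' => c k (Y z') : R^o) z.
  exact: differentiable_comp dY (dc k _).
have dG' k : differentiable (fun z' => 'd f (G z') (b k)) z.
  exact: differentiable_comp dG (dfb k).
have E : (fun z' => 'd f (G z') (Y z')) =
    \sum_(k < m) (fun z' => (c k (Y z') : R) *: 'd f (G z') (b k)).
  apply/funext => z'; rewrite fct_sumE [in LHS](bE (Y z')) linear_sum.
  by apply: eq_bigr => k _; rewrite linearZ.
have ds k := differentiable_scale (dY' k) (dG' k).
split; first by rewrite E; apply: differentiable_sum => k; have [] := ds k.
move=> v; rewrite -deriveE; last first.
  by rewrite E; apply: differentiable_sum => k; have [] := ds k.
rewrite E derive_sum; last by move=> k; apply: diff_derivable; have [] := ds k.
have E2 : (fun x => 'd f x (Y z)) =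
    \sum_(k < m) (fun x => (c k (Y z) : R) *: 'd f x (b k)).
  apply/funext => x; rewrite fct_sumE [in LHS](bE (Y z)) linear_sum.
  by apply: eq_bigr => k _; rewrite linearZ.
rewrite -[X in _ = X + _]deriveE; last first.
  by rewrite E2; apply: differentiable_sum => k; apply: differentiableZ.
rewrite E2 derive_sum; last first.
  by move=> k; apply: diff_derivable; apply: differentiableZ.
rewrite [in X in _ = _ + X](bE ('d Y z v)) linear_sum -big_split /=.
apply: eq_bigr => k _; rewrite deriveE; last by have [] := ds k.
rewrite (ds k).2 deriveZ; last exact: diff_derivable.
rewrite deriveE // linearZ /=; congr (_ *: _ + _ *: _).
  by rewrite [LHS](congr1 (@^~ v) (diff_comp dG (dfb k))).
by rewrite [LHS](congr1 (@^~ v) (diff_comp dY (dc k _))) /= diff_lin.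
Qed.

Lemma derive_affine V W (f : V -> W) (x v : V) (w : W) :
  (\forall t \near (0 : R), f (t *: v + x) = f x + t *: w) -> 'D_v f x = w.
Proof.
move=> fE; apply/lim_near_cst => //.
apply: filter_app (nbhs_dnbhs_neq (0 : R)); apply: cvg_within; move: fE.
by apply: filterS => t /= -> t0; rewrite addrC addKr scalerA mulVf ?scale1r.
Qed.
End DifferentialOfDifferential.

(** * Atlases with smooth changes of charts *)

Lemma near_image2 (M : Type) (E : topologicalType) (f : M -> E) (A B : set M) p :
  (forall q q', A q -> B q' -> f q = f q' -> q = q') ->
  nbhs (f p) (f @` A) -> nbhs (f p) (f @` B) -> nbhs (f p) (f @` (A `&` B)).
Proof.
move=> finj nA nB; apply: filterS (filterI nA nB) => _ [[q Aq <-] [q' Bq' E']].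
by exists q => //; split=> //; rewrite (finj q q').
Qed.

(** The part of the manifold axioms that can be stated without a topology on [M]. The slit tangent
    bundle is a bare type, and both it and the base satisfy this. *)
Definition smooth_atlas (R : realType) (E : normedModType R) (M : Type)
    (A : atlas M E) : Prop :=
  [/\ forall (i : chart A) p q, cdom i p -> cdom i q -> cmap i p = cmap i q -> p = q,
      forall i j : chart A, open (cmap i @` (cdom i `&` cdom j)) &
      forall i j : chart A,
        smooth_on (loc i (cmap j)) (cmap i @` (cdom i `&` cdom j))].

(** * Tangent vectors, coordinate fields and brackets in charts *)

Section Atlas.
Context {R : realType} {E : normedModType R} {M : Type} {A : atlas M E}.
Hypothesis sA : smooth_atlas A.
Implicit Types (i j k : chart A) (p q : M).

Lemma chart_inj i p q : cdom i p -> cdom i q -> cmap i p = cmap i q -> p = q.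
Proof. by have [+ _ _] := sA; apply. Qed.

Lemma locE (W : nmodType) i (f : M -> W) p : cdom i p -> loc i f (cmap i p) = f p.
Proof.
move=> ip; rewrite /loc; case: pselect => [h|[]]; last by exists p.
by case: (cid h) => q [iq qp] /=; rewrite (chart_inj iq ip qp).
Qed.

Lemma near_overlap i j p : cdom i p -> cdom j p ->
  nbhs (cmap i p) (cmap i @` (cdom i `&` cdom j)).
Proof.
have [_ oA _] := sA => ip jp; apply: open_nbhs_nbhs; split=> //.
by exists p.
Qed.

Lemma near_overlap3 i j k p : cdom i p -> cdom j p -> cdom k p ->
  nbhs (cmap i p) (cmap i @` [set q | [/\ cdom i q, cdom j q & cdom k q]]).
Proof.
move=> ip jp kp.
have := near_image2 _ (near_overlap ip jp) (near_overlap ip kp).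
have inj q q' : (cdom i `&` cdom j) q -> (cdom i `&` cdom k) q' ->
    cmap i q = cmap i q' -> q = q'.
  by move=> [iq _] [iq' _]; exact: chart_inj.
move=> /(_ inj); apply: filterS => _ [q [[iq jq] [_ kq]] <-].
by exists q.
Qed.

Lemma transition_differentiable i j p : cdom i p -> cdom j p ->
  differentiable (loc i (cmap j)) (cmap i p).
Proof.
have [_ _ smA] := sA => ip jp; apply: (Ck_differentiable (smA i j 1%N)).
by exists p.
Qed.

Lemma diff_transition_comp i j k p v : cdom i p -> cdom j p -> cdom k p ->
  'd (loc i (cmap k)) (cmap i p) v =
  'd (loc j (cmap k)) (cmap j p) ('d (loc i (cmap j)) (cmap i p) v).
Proof.
move=> ip jp kp.
have dij := transition_differentiable ip jp.
have djk := transition_differentiable jp kp.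
rewrite -[in RHS](locE (cmap j) ip).
rewrite -[in X in differentiable _ X](locE (cmap j) ip) in djk.
rewrite -[RHS](congr1 (@^~ v) (diff_comp dij djk)).
apply: (congr1 (@^~ v)); apply: near_eq_diff.
apply: filterS (near_overlap3 ip jp kp) => _ [q [iq jq kq] <-] /=.
by rewrite !locE.
Qed.

Lemma diff_transition_id i p v : cdom i p -> 'd (loc i (cmap i)) (cmap i p) v = v.
Proof.
move=> ip; transitivity ('d (@idfun E) (cmap i p) v); last first.
  by rewrite diff_val.
apply: (congr1 (@^~ v)); apply: near_eq_diff.
by apply: filterS (near_overlap ip ip) => _ [q [iq _] <-]; rewrite locE.
Qed.

(** By the cocycle identity for the differentials of the transition maps, compatibility with a
    single chart at [p] implies compatibility between any two. *)
Lemma is_tangent_of_chart i p (F : chart A -> E) : cdom i p ->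
  (forall j, ~ cdom j p -> F j = 0) ->
  (forall j, cdom j p -> F j = 'd (loc i (cmap j)) (cmap i p) (F i)) ->
  is_tangent p F.
Proof.
move=> ip F0 FE; split=> // j k jp kp.
by rewrite (FE k kp) (diff_transition_comp _ ip jp kp) -(FE j jp).
Qed.

Lemma tangentP p (X : tangent A p) : is_tangent p X.
Proof. by case: X => X /= /asboolP. Qed.

Lemma tangentE p (X : tangent A p) i j : cdom i p -> cdom j p ->
  X j = 'd (loc i (cmap j)) (cmap i p) (X i).
Proof. by have [_] := tangentP X; apply. Qed.

Lemma tangent_out p (X : tangent A p) i : ~ cdom i p -> X i = 0.
Proof. by have [+ _] := tangentP X; apply. Qed.

Lemma tangent_ext p (X Y : tangent A p) i : cdom i p -> X i = Y i -> X = Y.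
Proof.
move=> ip XY; apply: val_inj; apply/funext => j /=.
have [jp|jp] := pselect (cdom j p); last by rewrite !tangent_out.
by rewrite !(tangentE _ ip jp) XY.
Qed.

Lemma mk_tangentE p (F : chart A -> E) i : is_tangent p F -> mk_tangent A p F i = F i.
Proof. by move=> /asboolP Fp; rewrite /mk_tangent -[LHS]/(val _ i) insubdK. Qed.

Lemma tangent_lin p (a : R) (X Y : tangent A p) i : (a *: X + Y) i = a *: X i + Y i.
Proof. by []. Qed.

Lemma tangent0 p i : (0 : tangent A p) i = 0.
Proof. by []. Qed.

Lemma coord_vectorE i j p e : cdom i p -> cdom j p ->
  coord_vector i e p j = 'd (loc i (cmap j)) (cmap i p) e.
Proof.
move=> ip jp; rewrite /coord_vector mk_tangentE; first by case: asboolP => // -[].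
apply: (is_tangent_of_chart ip) => [k kp|k kp]; first by case: asboolP => // -[].
by do 2![case: asboolP => [_|[]//]]; rewrite diff_transition_id.
Qed.

Lemma coord_vector_self i p e : cdom i p -> coord_vector i e p i = e.
Proof. by move=> ip; rewrite coord_vectorE // diff_transition_id. Qed.

Lemma coord_vector_tangent i p (X : tangent A p) : cdom i p -> coord_vector i (X i) p = X.
Proof. by move=> ip; apply: (tangent_ext ip); rewrite coord_vector_self. Qed.

Lemma smooth_near_differentiable (W : normedModType R) (f : M -> W) i p :
  smooth_near A f p -> cdom i p -> differentiable (loc i f) (cmap i p).
Proof. by move=> sf ip; have [U [oU Up _ /(_ 1%N)[df _]]] := sf i ip; exact: df. Qed.

Lemma smooth_coord_vector i e p : finite_dim E -> cdom i p ->
  smooth_vfield_near (coord_vector i e) p.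
Proof.
have [_ oA smA] := sA => fE ip j jp k kp.
exists ((cmap k @` (cdom k `&` cdom i)) `&` (cmap k @` (cdom k `&` cdom j))); split.
- exact: openI.
- by split; exists p.
- by move=> _ [[q [kq _] <-] _]; exists q.
(* Read in chart [k], the component in chart [j] is the derivative along [e] of the transition from
   [i] to [j], composed with the transition from [k] to [i]; one order of smoothness is spent on the
   derivative. *)
move=> m; have [_ /(_ e) sm] := smA i j m.+1.
have oU := openI (oA k i) (oA k j).
have tri z : ((cmap k @` (cdom k `&` cdom i)) `&` (cmap k @` (cdom k `&` cdom j))) z ->
    exists q, [/\ cdom k q, cdom i q, cdom j q & cmap k q = z].
  move=> [[q [kq iq] <-] [q' [kq' jq'] qq']]; exists q; split=> //.
  by rewrite (chart_inj kq kq' (esym qq')).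
have := Ck_comp fE oU _ sm (Ck_sub (@subIsetl _ _ _) (smA k i m)).
have tr2 z : ((cmap k @` (cdom k `&` cdom i)) `&` (cmap k @` (cdom k `&` cdom j))) z ->
    (cmap i @` (cdom i `&` cdom j)) (loc k (cmap i) z).
  by move=> /tri[q [kq iq jq <-]]; rewrite locE //; exists q.
move=> /(_ tr2); apply: Ck_ext => // z /tri[q [kq iq jq <-]].
rewrite !locE // coord_vectorE // deriveE //.
exact: transition_differentiable.
Qed.

(** The commutation hypothesis is what cancels the second derivatives of the transition maps, so
    that the family defining the bracket is tangent and [mk_tangent] does not fall back on 0. The
    chart is the one selected by [some_chart] because [tder] computes there. *)
Lemma lie_bracketE i p (X Y : vfield A) : finite_dim E -> some_chart A p = Some i ->
  differentiable (loc i (fun q => X q i)) (cmap i p) ->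
  differentiable (loc i (fun q => Y q i)) (cmap i p) ->
  (forall j, cdom j p ->
    'd (fun z => 'd (loc i (cmap j)) z (Y p i)) (cmap i p) (X p i) =
    'd (fun z => 'd (loc i (cmap j)) z (X p i)) (cmap i p) (Y p i)) ->
  lie_bracket X Y p i =
    'd (loc i (fun q => Y q i)) (cmap i p) (X p i) -
    'd (loc i (fun q => X q i)) (cmap i p) (Y p i).
Proof.
have [_ oA smA] := sA => fE ipE dX dY comm.
have ip : cdom i p.
  by move: ipE; rewrite /some_chart; case: pselect => // h [<-]; case: (cid h).
(* Product rule for the transformation law: near [p] the component of [Z] in chart [j] is the
   differential of the transition map applied to its component in chart [i]. *)
have derj (Z : vfield A) j v : cdom j p ->
    differentiable (loc i (fun q => Z q i)) (cmap i p) ->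
    'd (loc i (fun q => Z q j)) (cmap i p) v =
    'd (fun z => 'd (loc i (cmap j)) z (Z p i)) (cmap i p) v +
    'd (loc i (cmap j)) (cmap i p) ('d (loc i (fun q => Z q i)) (cmap i p) v).
  move=> jp dZ.
  have Uij : (cmap i @` (cdom i `&` cdom j)) (idfun (cmap i p)) by exists p.
  have [_ /(_ v)] := diff_along fE (oA i j) Uij (smA i j 2%N)
    (ex_diff (is_diff_def := is_diff_id _)) dZ.
  rewrite locE // diff_val => <-.
  apply: (congr1 (@^~ v)); apply: near_eq_diff.
  apply: filterS (near_overlap ip jp) => _ [q [iq jq] <-] /=.
  by rewrite !locE // (tangentE _ iq jq).
have tderE (W : normedModType R) (Z : tangent A p) (f : M -> W) :
  tder Z f = 'd (loc i f) (cmap i p) (Z i) by rewrite /tder ipE.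
have FE j : cdom j p ->
  tder (X p) (fun q => Y q j) - tder (Y p) (fun q => X q j) =
  'd (loc i (cmap j)) (cmap i p)
    ('d (loc i (fun q => Y q i)) (cmap i p) (X p i) -
     'd (loc i (fun q => X q i)) (cmap i p) (Y p i)).
  move=> jp; rewrite !tderE.
  have cancel_l (a a' b b' : E) : a = a' -> (a + b) - (a' + b') = b - b'.
    by move=> ->; rewrite opprD addrACA subrr add0r.
  apply: etrans (f_equal2 (fun a b => a - b) (derj Y j _ jp dY) (derj X j _ jp dX)) _.
  exact: etrans (cancel_l _ _ _ _ (comm j jp)) (esym (raddfB _ _ _)).
rewrite /lie_bracket mk_tangentE; first by case: asboolP => // _; rewrite !tderE.
apply: (is_tangent_of_chart ip) => [j|j jp]; first by case: asboolP.
case: asboolP => // _; rewrite FE //; case: asboolP => // _.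
by rewrite !tderE.
Qed.

End Atlas.

(** * The slit tangent bundle *)

(** Same frame expansion as for composites. With [G] and [Y] the two projections, this handles the
    fibre component of the transition maps of the slit bundle. *)
Lemma Ck_diff_along (R : realType) (V W Z : normedModType R) k (f : V -> W)
    (U : set V) (G Y : Z -> V) (U' : set Z) :
  finite_dim V -> open U -> open U' -> (forall z, U' z -> U (G z)) ->
  Ck k.+1 f U -> Ck k G U' -> Ck k Y U' ->
  Ck k (fun z => 'd f (G z) (Y z)) U'.
Proof.
move=> fV oU oU' GU [df cf] cG cY; have [m [b [c [cc bE]]]] := fV.
have : Ck k (fun z => \sum_(i < m) (c i (Y z) : R) *: 'D_(b i) f (G z)) U'.
  apply: Ck_sum => // i; apply: Ck_scale => //; first exact: Ck_linear_comp cY.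
  exact: Ck_comp fV oU' GU (cf (b i)) cG.
apply: Ck_ext => // z Uz; rewrite [in RHS](bE (Y z)) linear_sum.
by apply: eq_bigr => i _; rewrite linearZ /= (@deriveE _ _ _ f) //; exact/df/GU.
Qed.

Lemma some_chartP (R : realType) (E : normedModType R) (M : Type) (A : atlas M E)
    (p : M) (i : chart A) :
  some_chart A p = Some i -> cdom i p.
Proof. by rewrite /some_chart; case: pselect => // h [<-]; case: (cid h). Qed.

Lemma some_chart_exists (R : realType) (E : normedModType R) (M : Type)
    (A : atlas M E) (p : M) (i : chart A) :
  cdom i p -> exists j, some_chart A p = Some j.
Proof.
move=> ip; rewrite /some_chart; case: pselect => [h|[]]; last by exists i.
by exists (projT1 (cid h)).
Qed.

Section Slit.
Context {R : realType} {n : nat} {M : Type} {A : atlas M 'rV[R]_n}.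
Local Notation E := 'rV[R]_n.
Hypothesis sA : smooth_atlas A.
Implicit Types (i j k : chart A) (u w : slit A).
Local Notation Tslit u := (tangent (slit_atlas A) u).
Local Notation pi_fiber u := (tangent A (foot u)).
(* The chart of the slit bundle induced by i: its index is i itself, seen in a
   type convertible to [chart A]. *)
Local Notation sl i := (i : chart (slit_atlas A)).

Lemma slit_ext u w i : cdom i (foot u) -> foot u = foot w -> fib u i = fib w i -> u = w.
Proof.
case: u w => [p v v0] [q w w0] /= ip pq; move: w w0; rewrite -pq => w w0 vw.
have E := tangent_ext ip vw; move: v0; rewrite E => v0.
by rewrite (bool_irrelevance v0 w0).
Qed.

Lemma fib_coord_neq0 u i : cdom i (foot u) -> fib u i != 0.
Proof.
move=> iu; apply/eqP => u0; have /eqP := fib_neq0 u; apply.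
by apply: (tangent_ext iu); rewrite u0.
Qed.

Lemma slit_exists i p (y : E) : cdom i p -> y != 0 ->
  exists u, foot u = p /\ cmap (sl i) u = (cmap i p, y).
Proof.
move=> ip y0; have c0 : coord_vector i y p != 0.
  apply/eqP => c0; move: y0; rewrite -(coord_vector_self sA y ip) c0.
  by rewrite tangent0 eqxx.
by exists (Slit c0); split=> //=; rewrite (coord_vector_self sA).
Qed.

Lemma slit_image (B : set M) i : B `<=` cdom i ->
  cmap (sl i) @` [set u | B (foot u)] =
  [set z | (cmap i @` B) z.1 /\ z.2 != 0].
Proof.
move=> Bi; apply/seteqP; split.
  move=> _ [u Bu <-]; split; first by exists (foot u).
  by apply: fib_coord_neq0; apply: Bi.
move=> [x y] [[p Bp /= <-] y0].
by have [u [up uE]] := slit_exists (Bi _ Bp) y0; exists u => //=; rewrite up.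
Qed.

Lemma open_slit (V W : normedModType R) (U : set V) : open U ->
  open [set z : V * W | U z.1 /\ z.2 != 0].
Proof.
move=> oU; rewrite (_ : [set _ | _] = (fst @^-1` U) `&` (snd @^-1` [set w : W | w != 0])) //.
apply: openI; first by apply: open_comp => // z _; exact: cvg_fst.
apply: open_comp => [z _|]; first exact: cvg_snd.
have -> : [set w : W | w != 0] = ~` [set 0].
  by apply/seteqP; split=> w /=; [move/eqP|move/eqP].
rewrite openC; apply: accessible_closed_set1.
exact/hausdorff_accessible/norm_hausdorff.
Qed.

Lemma slit_overlap i j :
  cmap (sl i) @` (cdom (sl i) `&` cdom (sl j)) =
  [set z | (cmap i @` (cdom i `&` cdom j)) z.1 /\ z.2 != 0].
Proof. by rewrite -slit_image // => p []. Qed.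

Lemma open_slit_overlap i j : open (cmap (sl i) @` (cdom (sl i) `&` cdom (sl j))).
Proof. by rewrite slit_overlap; apply: open_slit; case: sA. Qed.

Lemma slit_chart_inj i u w : cdom i (foot u) -> cdom i (foot w) ->
  cmap (sl i) u = cmap (sl i) w -> u = w.
Proof.
move=> iu iw [xE yE]; apply: (slit_ext iu) => //.
exact: (chart_inj sA iu iw).
Qed.

Lemma slit_locE (W : nmodType) i (f : slit A -> W) u : cdom i (foot u) ->
  loc (sl i) f (cmap (sl i) u) = f u.
Proof.
move=> iu; rewrite /loc; case: pselect => [h|[]]; last by exists u.
by case: (cid h) => q [iq qp] /=; rewrite (slit_chart_inj iq iu qp).
Qed.

Lemma slit_transition i j u : cdom i (foot u) -> cdom j (foot u) ->
  loc (sl i) (cmap (sl j)) (cmap (sl i) u) =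
  (loc i (cmap j) (cmap i (foot u)),
   'd (loc i (cmap j)) (cmap i (foot u)) (fib u i)).
Proof. by move=> iu ju; rewrite slit_locE //= (locE sA) // -(tangentE _ iu ju). Qed.

Lemma Ck_fst (V W : normedModType R) (m : nat) (U : set (V * W)) : open U ->
  Ck m (fst : V * W -> V) U.
Proof.
move=> oU; apply: (Ck_linear_comp (l := fst) oU (f := idfun)); last exact: Ck_id.
by move=> x; exact: cvg_fst.
Qed.

Lemma Ck_snd (V W : normedModType R) (m : nat) (U : set (V * W)) : open U ->
  Ck m (snd : V * W -> W) U.
Proof.
move=> oU; apply: (Ck_linear_comp (l := snd) oU (f := idfun)); last exact: Ck_id.
by move=> x; exact: cvg_snd.
Qed.

(** With phi the transition map of the base, that of the slit bundle is (x, y) |-> (phi x, dphi_x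
    y). The second component uses one more order of smoothness of phi than is obtained. *)
Lemma smooth_atlas_slit : smooth_atlas (slit_atlas A).
Proof.
have [_ oA smA] := sA; split.
- by move=> i u w; exact: slit_chart_inj.
- exact: open_slit_overlap.
suff H i j : smooth_on (loc (sl i) (cmap (sl j)))
    (cmap (sl i) @` (cdom (sl i) `&` cdom (sl j))) by move=> i j; exact: H.
move=> k; have oS := @open_slit_overlap i j.
have inU z : (cmap (sl i) @` (cdom (sl i) `&` cdom (sl j))) z ->
    (cmap i @` (cdom i `&` cdom j)) z.1 by rewrite slit_overlap => -[].
have c1 : Ck k (fst : E * E -> E) (cmap (sl i) @` (cdom (sl i) `&` cdom (sl j))).
  exact: Ck_fst.
have c2 : Ck k (snd : E * E -> E) (cmap (sl i) @` (cdom (sl i) `&` cdom (sl j))).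
  exact: Ck_snd.
have := Ck_pair oS (Ck_comp (finite_dim_rV _) oS inU (smA i j k) c1)
  (Ck_diff_along (finite_dim_rV _) (oA i j) oS inU (smA i j k.+1) c1 c2).
by apply: Ck_ext => // _ [u [iu ju] <-]; rewrite slit_transition.
Qed.

(** This is [smooth_near] itself, with the index of the induced chart typed as a chart of [A]. *)
Lemma smooth_near_slit (W : normedModType R) (f : slit A -> W) u :
  (forall i, cdom i (foot u) -> exists U : set (E * E),
    [/\ open U, U (cmap (sl i) u), U `<=` cimage (sl i) &
        smooth_on (loc (sl i) f) U]) ->
  smooth_near (slit_atlas A) f u.
Proof. by move=> H i; exact: H. Qed.

Lemma smooth_near_foot (W : normedModType R) (f : M -> W) u :
  smooth_near A f (foot u) -> smooth_near (slit_atlas A) (fun w => f (foot w)) u.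
Proof.
move=> sf; apply: smooth_near_slit => i iu; have [U [oU Uu Ui smf]] := sf i iu.
have oS : open [set z : E * E | U z.1 /\ z.2 != 0] by exact: open_slit.
have SE (z : E * E) : U z.1 /\ z.2 != 0 -> exists w, cdom i (foot w) /\ cmap (sl i) w = z.
  case: z => x y [/Ui [p ip /= <-] y0].
  have [w [wp wE]] := slit_exists ip y0; exists w; split; last exact: wE.
  by rewrite wp.
exists [set z : E * E | U z.1 /\ z.2 != 0]; split=> //.
- by split=> //=; apply: fib_coord_neq0.
- by move=> z /SE[w [iw <-]]; exists w.
move=> k; have := Ck_comp (finite_dim_rV _) oS _ (smf k) (@Ck_fst E E k _ oS).
have sub (z : E * E) : [set z : E * E | U z.1 /\ z.2 != 0] z -> U z.1 by case.
move=> /(_ sub); apply: Ck_ext => // z /SE[w [iw <-]] /=.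
by rewrite slit_locE // (locE sA).
Qed.

Lemma smooth_eta u : smooth_pi_near (@eta R n M A) u.
Proof.
move=> j ju; apply: smooth_near_slit => i iu; have [_ oA smA] := sA.
have oS := @open_slit_overlap i j.
exists (cmap (sl i) @` (cdom (sl i) `&` cdom (sl j))); split=> //.
- by exists u.
- by move=> _ [w [iw _] <-]; exists w.
move=> k; have inU z : (cmap (sl i) @` (cdom (sl i) `&` cdom (sl j))) z ->
    (cmap i @` (cdom i `&` cdom j)) z.1 by rewrite slit_overlap => -[].
have := Ck_diff_along (finite_dim_rV _) (oA i j) oS inU (smA i j k.+1)
  (Ck_fst _ oS) (Ck_snd _ oS).
by apply: Ck_ext => // _ [w [iw jw] <-]; rewrite slit_locE //= -(tangentE (A := A) (fib w) iw jw).
Qed.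

(** Supplies smooth sections with a prescribed value at [u]: a vector is extended with constant
    components in a chart. *)
Lemma smooth_pi_coord i e u : cdom i (foot u) ->
  smooth_pi_near (fun w => coord_vector i e (foot w)) u.
Proof.
move=> iu j ju; apply: (@smooth_near_foot _ (fun q => coord_vector i e q j)).
exact: (smooth_coord_vector sA e (finite_dim_rV _) iu ju).
Qed.

Lemma diff_fst (V W : normedModType R) (z v : V * W) :
  differentiable (fst : V * W -> V) z /\ 'd (fst : V * W -> V) z v = v.1.
Proof.
have cf : continuous (fst : V * W -> V) by move=> x; exact: cvg_fst.
by split; [exact: linear_differentiable|rewrite diff_lin].
Qed.

Lemma diff_snd (V W : normedModType R) (z v : V * W) :
  differentiable (snd : V * W -> W) z /\ 'd (snd : V * W -> W) z v = v.2.
Proof.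
have cf : continuous (snd : V * W -> W) by move=> x; exact: cvg_snd.
by split; [exact: linear_differentiable|rewrite diff_lin].
Qed.

Lemma diff_comp_fst (V W Z : normedModType R) (f : V -> Z) (z v : V * W) :
  differentiable f (z.1 : V) ->
  'd (fun z' : V * W => f z'.1) z v = 'd f (z.1 : V) v.1.
Proof.
move=> df; have [d1 d1E] := diff_fst z v.
by rewrite [LHS](congr1 (@^~ v) (diff_comp d1 df)) /= d1E.
Qed.

Lemma diff_slit_transition i j u (v : E * E) : cdom i (foot u) -> cdom j (foot u) ->
  'd (loc (sl i) (cmap (sl j))) (cmap (sl i) u) v =
  ('d (loc i (cmap j)) (cmap i (foot u)) v.1,
   'd (fun x => 'd (loc i (cmap j)) x (fib u i)) (cmap i (foot u)) v.1 +
   'd (loc i (cmap j)) (cmap i (foot u)) v.2).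
Proof.
move=> iu ju; have [_ oA smA] := sA.
have [d1 d1E] := diff_fst (cmap (sl i) u) v.
have [d2 d2E] := diff_snd (cmap (sl i) u) v.
have Uu : (cmap i @` (cdom i `&` cdom j)) (cmap (sl i) u).1 by exists (foot u).
have [d3 d3E] := diff_along (finite_dim_rV _) (oA i j) Uu (smA i j 2%N) d1 d2.
have dij := transition_differentiable sA iu ju.
have d4 : differentiable (fun z : E * E => loc i (cmap j) z.1) (cmap (sl i) u).
  exact: (differentiable_comp d1 dij).
pose Psi (z : E * E) : E * E :=
  (loc i (cmap j) z.1, 'd (loc i (cmap j) : E -> E) (z.1 : E) z.2).
have -> : 'd (loc (sl i) (cmap (sl j))) (cmap (sl i) u) v =
    'd Psi (cmap (sl i) u) v.
  apply: (congr1 (@^~ v)); apply: near_eq_diff.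
  apply: filterS (near_overlap smooth_atlas_slit iu ju) => _ [w [iw jw] <-].
  by rewrite slit_transition.
rewrite (diff_pair d4 d3) /=; congr pair.
  exact: diff_comp_fst.
apply: etrans (d3E v) _.
exact: (f_equal2 (fun a b : E =>
  'd (fun x : E => 'd (loc i (cmap j) : E -> E) x (fib u i) : E) (cmap i (foot u)) a +
  'd (loc i (cmap j) : E -> E) (cmap i (foot u)) b) d1E d2E).
Qed.

Lemma diff_slit_transition_vertical i j u (y : E) : cdom i (foot u) -> cdom j (foot u) ->
  'd (loc (sl i) (cmap (sl j))) (cmap (sl i) u) (0, y) =
  (0, 'd (loc i (cmap j)) (cmap i (foot u)) y).
Proof.
move=> iu ju; apply: etrans (diff_slit_transition _ iu ju) _.
apply: (f_equal2 pair); first exact: linear0.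
by rewrite [X in X + _ = _]linear0 add0r.
Qed.

(** A vertical vector (0, y) is sent by a change of induced charts to (0, dphi y), so the family in
    [gamma] is tangent. Outside the domain of chart [i] both sides are 0. *)
Lemma gammaE u (v : pi_fiber u) i : gamma v i = (0, v i).
Proof.
have [iu|iu] := pselect (cdom i (foot u)); last first.
  by rewrite (tangent_out v iu) (tangent_out (gamma v)).
rewrite /gamma mk_tangentE //.
apply: (is_tangent_of_chart smooth_atlas_slit iu) => [j ju|j ju].
  by rewrite (tangent_out v ju).
by rewrite diff_slit_transition_vertical // -(tangentE v iu ju).
Qed.

(** [tder] evaluates in the chart selected by [some_chart]; the base part of the slit transition
    carries the result over to the other charts. *)
Lemma rhoE u (X : Tslit u) i : cdom i (foot u) -> rho X i = (X i).1.
Proof.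
have tanX j k : cdom j (foot u) -> cdom k (foot u) ->
    (X k).1 = 'd (loc j (cmap k)) (cmap j (foot u)) (X j).1.
  by move=> ju ku; rewrite (tangentE X ju ku) diff_slit_transition.
have tderE j : cdom j (foot u) -> tder X (fun w => cmap j (foot w)) = (X j).1.
  move=> ju; rewrite /tder; have [k E1] := some_chart_exists (ju : cdom (sl j) u).
  rewrite E1; have ku := some_chartP E1; rewrite (tanX k j) //.
  rewrite -(diff_comp_fst (z := cmap (sl k) u)); last exact: (transition_differentiable sA).
  apply: (congr1 (@^~ _)); apply: near_eq_diff.
  apply: filterS (near_overlap smooth_atlas_slit ku ju) => _ [w [kw jw] <-].
  by rewrite slit_locE //= (locE sA).
move=> iu; rewrite /rho /pushforward mk_tangentE; first by case: asboolP => // _; exact: tderE.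
apply: (is_tangent_of_chart sA iu) => [j|j ju]; first by case: asboolP.
by do 2![case: asboolP => // _]; rewrite !tderE //; exact: tanX.
Qed.

End Slit.

(** * Differentiability of the horizontal lift *)

Section MatrixDifferentiability.
Context {R : realType} {Z : normedModType R}.

Lemma differentiable_bigprod m (F : 'I_m -> Z -> R^o) z :
  (forall i, differentiable (F i) z) ->
  differentiable (fun z' => \prod_(i < m) (F i z' : R) : R^o) z.
Proof.
elim: m F => [|m IH] F dF.
  have -> : (fun z' => \prod_(i < 0) (F i z' : R) : R^o) = cst 1.
    by apply/funext => z'; rewrite big_ord0.
  exact: differentiable_cst.
have -> : (fun z' => \prod_(i < m.+1) (F i z' : R) : R^o) = (fun z' =>
    (F ord0 z' : R) *: (\prod_(i < m) (F (lift ord0 i) z' : R) : R^o)).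
  by apply/funext => z'; rewrite big_ord_recl.
have dF' : differentiable (fun z' => \prod_(i < m) (F (lift ord0 i) z' : R) : R^o) z.
  by apply: IH => i; exact: dF.
by have [] := differentiable_scale (dF ord0) dF'.
Qed.

Lemma differentiable_bigsum (W : normedModType R) (I : finType) (P : pred I)
    (F : I -> Z -> W) z :
  (forall i, differentiable (F i) z) ->
  differentiable (fun z' => \sum_(i | P i) F i z') z.
Proof.
move=> dF; have -> : (fun z' => \sum_(i | P i) F i z') = \sum_(i | P i) F i.
  by apply/funext => z'; rewrite fct_sumE.
elim/big_ind : _ => [|f g df dg|i _]; last exact: dF.
  exact: differentiable_cst.
exact: differentiableD.
Qed.

Lemma differentiable_det m (F : Z -> 'M[R]_m) z :
  (forall i j, differentiable (fun z' => F z' i j : R^o) z) ->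
  differentiable (fun z' => \det (F z') : R^o) z.
Proof.
move=> dF; apply: differentiable_bigsum => s.
have [+ _] := differentiable_scale (differentiable_cst ((-1) ^+ (odd_perm s) : R^o) z)
  (@differentiable_bigprod m (fun i z' => F z' i (s i)) z (fun i => dF i (s i))).
exact.
Qed.

(** Cramer's rule: an entry of the inverse is a cofactor divided by the determinant. Invertibility
    is required near [z] because [invmx] is given by this formula on invertible matrices only. *)
Lemma differentiable_invmx m (F : Z -> 'M[R]_m) z :
  (\forall z' \near z, F z' \in unitmx) ->
  (forall i j, differentiable (fun z' => F z' i j : R^o) z) ->
  forall i j, differentiable (fun z' => invmx (F z') i j : R^o) z.
Proof.
move=> uF dF i j.
have dcof : differentiable (fun z' => cofactor (F z') j i : R^o) z.
  have dd : differentiable (fun z' => \det (row' j (col' i (F z'))) : R^o) z.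
    apply: differentiable_det => a b.
    have -> : (fun z' => row' j (col' i (F z')) a b : R^o) =
      (fun z' => F z' (lift j a) (lift i b) : R^o).
      by apply/funext => z'; rewrite !mxE.
    exact: dF.
  have [+ _] := differentiable_scale (differentiable_cst ((-1) ^+ (j + i) : R^o) z) dd.
  exact.
have uz : F z \in unitmx by exact: nbhs_singleton uF.
have ddet : differentiable (fun z' => (\det (F z'))^-1 : R^o) z.
  have dz : \det (F z) != 0 by move: uz; rewrite unitmxE unitfE.
  exact: (differentiableV (differentiable_det dF) dz).
have [dp _] := differentiable_scale ddet dcof.
apply: near_eq_differentiable dp.
by apply: filterS uF => z' uz'; rewrite /invmx uz' !mxE.
Qed.

Lemma differentiable_rV n (f : Z -> 'rV[R]_n) z :
  (forall k, differentiable (fun z' => f z' 0 k : R^o) z) -> differentiable f z.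
Proof.
move=> df; have -> : f = (fun z' => \sum_(k < n) (f z' 0 k) *: delta_mx 0 k).
  by apply/funext => z'; exact: row_sum_delta.
apply: differentiable_bigsum => k.
have [+ _] := differentiable_scale (df k)
  (differentiable_cst (delta_mx 0 k : 'rV[R]_n) z).
exact.
Qed.

Lemma differentiable_entry (m n : nat) (f : Z -> 'M[R]_(m, n)) z i j :
  differentiable f z -> differentiable (fun z' => f z' i j : R^o) z.
Proof. by move=> df; exact: (differentiable_comp df (differentiable_coord (f z) i j)). Qed.

Lemma differentiable_mulmx_row m n (f : Z -> 'rV[R]_m) (F : Z -> 'M[R]_(m, n)) z :
  differentiable f z ->
  (forall i j, differentiable (fun z' => F z' i j : R^o) z) ->
  differentiable (fun z' => f z' *m F z') z.
Proof.
move=> df dF; apply: differentiable_rV => k.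
have -> : (fun z' => (f z' *m F z') 0 k : R^o) =
    (fun z' => \sum_i (f z' 0 i * F z' i k) : R^o).
  by apply/funext => z'; rewrite mxE.
apply: (@differentiable_bigsum R^o) => i.
by have [] := differentiable_scale (differentiable_entry 0 i df) (dF i k).
Qed.

End MatrixDifferentiability.

(** * The connection map in a chart and the horizontal lift *)

Section Connection.
Context {R : realType} {n : nat} {M : Type} {A : atlas M 'rV[R]_n}.
Local Notation E := 'rV[R]_n.
Hypothesis sA : smooth_atlas A.
Hypothesis chartsA : forall p, exists i : chart A, cdom i p.
Variable D : pi_derivation A.
Hypothesis regD : regular_connection D.
Implicit Types (i j k : chart A) (u w : slit A).
Local Notation Tslit u := (tangent (slit_atlas A) u).
Local Notation pi_fiber u := (tangent A (foot u)).
Local Notation sl i := (i : chart (slit_atlas A)).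
Let sS := smooth_atlas_slit sA.

Lemma rho_lin u (a : R) (X Y : Tslit u) : rho (a *: X + Y) = a *: rho X + rho Y.
Proof.
have [i iu] := chartsA (foot u); apply: (tangent_ext iu).
by rewrite tangent_lin !(rhoE sA) // tangent_lin.
Qed.

Lemma rho_gamma u (v : pi_fiber u) : rho (gamma v) = 0.
Proof.
have [i iu] := chartsA (foot u); apply: (tangent_ext iu).
by rewrite (rhoE sA) // (gammaE sA).
Qed.

Lemma Kmap_lin u (a : R) (X Y : Tslit u) :
  Kmap D (a *: X + Y) = a *: Kmap D X + Kmap D Y.
Proof. by have [[+ _] _] := regD; apply; exact: smooth_eta. Qed.

(** Regularity makes the set searched by [xget] nonempty: the horizontal part of any lift of [v] has
    the same image under rho, since the vertical part is killed. *)
Lemma betaP u (v : pi_fiber u) : Kmap D (beta D v) = 0 /\ rho (beta D v) = v.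
Proof.
have [i iu] := chartsA (foot u).
(* An arbitrary lift of [v], with zero fibre component in chart [i]. *)
pose X0 := coord_vector (sl i) (v i, 0 : E) u.
have rX0 : rho X0 = v.
  by apply: (tangent_ext iu); rewrite (rhoE sA) // (coord_vector_self sS).
have [_ /(_ u) [split_u _]] := regD.
have [X [Y [rX KY X0E]]] := split_u X0.
rewrite /beta; case: xgetP => [B _ //|/(_ Y)[]]; split=> //.
by rewrite -rX0 X0E -[X]scale1r rho_lin rX scaler0 add0r.
Qed.

Lemma derivation0 u (X : Tslit u) : D X (fun w => 0) = 0.
Proof.
have s0 : smooth_pi_near (fun w => 0 : pi_fiber w) u.
  move=> j ju; apply: smooth_near_slit => i iu.
  exists (cmap (sl i) @` (cdom (sl i) `&` cdom (sl i))); split.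
  - by have [_ + _] := sS; apply.
  - by exists u.
  - by move=> _ [w [iw _] <-]; exists w.
  move=> m; apply: Ck_ext (Ck_cst m (0 : E) _); first by have [_ + _] := sS; apply.
  by move=> _ [w [iw _] <-]; rewrite (slit_locE sA).
have [[_ [/(_ u X _ _ s0 s0) DD _]] _] := regD.
have E0 : (fun w => (0 : pi_fiber w) + 0) = (fun w => 0 : pi_fiber w).
  by apply: functional_extensionality_dep => w; rewrite addr0.
by move: DD; rewrite E0 => /eqP; rewrite -subr_eq subrr => /eqP <-.
Qed.

Lemma mixed_torsionE u (X Y : pi_field A) :
  mixed_torsion D X Y u =
  D (gamma (X u)) Y -
  rho (lie_bracket (fun w => gamma (X w)) (fun w => beta D (Y w)) u).
Proof.
rewrite /mixed_torsion /torsion.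
have -> : (fun w => rho (beta D (Y w))) = Y.
  by apply: functional_extensionality_dep => w; have [] := betaP (Y w).
have -> : (fun w => rho (gamma (X w))) = (fun w => 0).
  by apply: functional_extensionality_dep => w; exact: rho_gamma.
by rewrite derivation0 subr0.
Qed.

Definition Kcoord i w (e : E * E) : E := Kmap D (coord_vector (sl i) e w) i.

(** [Kvert] and [Khor] are the two blocks of the matrix of K in an induced chart, acting on row
    vectors from the right. In [Khor] the directions are the coordinate vectors (e, 0) of the chart,
    not elements of the horizontal space ker K. *)
Definition Kvert i w : 'M[R]_n := \matrix_(a < n) Kcoord i w (0, delta_mx 0 a).
Definition Khor i w : 'M[R]_n := \matrix_(a < n) Kcoord i w (delta_mx 0 a, 0).

Lemma Kcoord_lin i w : cdom i (foot w) -> linear (Kcoord i w).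
Proof.
move=> iw a e e'; rewrite /Kcoord.
have -> : coord_vector (sl i) (a *: e + e') w =
    a *: coord_vector (sl i) e w + coord_vector (sl i) e' w.
  apply: (@tangent_ext _ _ _ (slit_atlas A) _ _ _ i iw).
  by rewrite tangent_lin !(coord_vector_self sS).
by rewrite Kmap_lin.
Qed.

Lemma KcoordE i w (a b : E) : cdom i (foot w) ->
  Kcoord i w (a, b) = a *m Khor i w + b *m Kvert i w.
Proof.
move=> iw; pose L : {linear (E * E)%type -> E} :=
  HB.pack (Kcoord i w) (GRing.isLinear.Build _ _ _ _ _ (Kcoord_lin iw)).
have LE e : Kcoord i w e = L e by [].
have LZ c e : L (c *: e) = c *: Kcoord i w e by rewrite linearZ_LR.
have -> : (a, b) = (a, 0) + (0, b) :> E * E by rewrite pair_addE addr0 add0r.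
rewrite LE raddfD /=; congr (_ + _).
  have -> : (a, 0) = \sum_(k < n) a 0 k *: (delta_mx 0 k, 0) :> E * E.
    rewrite [in LHS](row_sum_delta a).
    by elim/big_ind2 : _ => // [? ? ? ? <- <-|k _]; rewrite ?pair_addE ?pair_scaleE ?addr0 ?scaler0.
  rewrite -[LHS]/(L _) raddf_sum mulmx_sum_row; apply: eq_bigr => k _.
  by rewrite rowK; exact: LZ.
have -> : (0, b) = \sum_(k < n) b 0 k *: (0, delta_mx 0 k) :> E * E.
  rewrite [in LHS](row_sum_delta b).
  by elim/big_ind2 : _ => // [? ? ? ? <- <-|k _]; rewrite ?pair_addE ?pair_scaleE ?addr0 ?scaler0.
rewrite -[LHS]/(L _) raddf_sum mulmx_sum_row; apply: eq_bigr => k _.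
by rewrite rowK; exact: LZ.
Qed.

(** A row vector killed by this block gives a vector that is both vertical and horizontal, hence 0
    by regularity; an injective square matrix is invertible. *)
Lemma Kvert_unit i w : cdom i (foot w) -> Kvert i w \in unitmx.
Proof.
move=> iw; have inj (x : E) : x *m Kvert i w = 0 -> x = 0.
  move=> x0; pose X := coord_vector (sl i) (0 : E, x) w.
  have Xi : X i = (0, x) by rewrite (coord_vector_self sS).
  have KX : Kmap D X = 0.
    apply: (tangent_ext iw); rewrite -[LHS]/(Kcoord i w (0, x)) KcoordE //.
    by rewrite mul0mx add0r x0.
  have rX : rho X = 0 by apply: (tangent_ext iw); rewrite (rhoE sA) // Xi.
  have [_ /(_ w)[_ /(_ X rX KX) X0]] := regD.
  by move: Xi; rewrite X0 tangent0 => -[].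
rewrite -row_free_unit -kermx_eq0; apply/eqP/row_matrixP => k.
by rewrite row0; apply: inj; rewrite -row_mul mulmx_ker row0.
Qed.

(* beta v is the solution (v, b) of K (v, b) = 0 in a chart. *)
Lemma betaE i w (v : pi_fiber w) : cdom i (foot w) ->
  beta D v i = (v i, - (v i *m Khor i w) *m invmx (Kvert i w)).
Proof.
move=> iw; have [Kb rb] := betaP v.
have b1 : (beta D v i).1 = v i by rewrite -(rhoE sA) // rb.
have := coord_vector_tangent sS (beta D v) iw => cE.
have : Kcoord i w (beta D v i) = 0 by rewrite /Kcoord cE Kb.
case: (beta D v i) b1 => a b /= ->; rewrite KcoordE // => /eqP.
rewrite addrC addr_eq0 => /eqP <-.
by rewrite mulmxK ?Kvert_unit.
Qed.

(** The last axiom of a linear connection, applied to a coordinate field and the smooth section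
    [eta], makes the coefficients of K smooth. *)
Lemma differentiable_Kcoord i u (e : E * E) : cdom i (foot u) ->
  differentiable (loc (sl i) (fun w => Kcoord i w e)) (cmap (sl i) u).
Proof.
move=> iu; have fE := finite_dim_pair (@finite_dim_rV R n) (@finite_dim_rV R n).
have sX := smooth_coord_vector sS e fE (iu : cdom (sl i) u).
have [[_ [_ [_ /(_ u _ _ sX (@smooth_eta _ _ _ _ sA u)) sK]]] _] := regD.
exact: (@smooth_near_differentiable _ _ _ (slit_atlas A) _ _ i u (sK i iu) iu).
Qed.

(** The choice made in [beta] says nothing about its dependence on the base point. The explicit
    solution [betaE] expresses it through the blocks of K and an inverse matrix, all of which are
    differentiable. *)
Lemma differentiable_beta i u (Y : pi_field A) : cdom i (foot u) ->
  smooth_pi_near Y u ->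
  differentiable (loc (sl i) (fun w => beta D (Y w) i)) (cmap (sl i) u).
Proof.
move=> iu sY.
have dY := @smooth_near_differentiable _ _ _ (slit_atlas A) _ _ i u (sY i iu) iu.
have near_i := near_overlap sS (iu : cdom (sl i) u) (iu : cdom (sl i) u).
pose H z := loc (sl i) (Khor i) z; pose V z := loc (sl i) (Kvert i) z.
have dH a b : differentiable (fun z => H z a b : R^o) (cmap (sl i) u).
  have := differentiable_entry 0 b (differentiable_Kcoord (delta_mx 0 a, 0) iu).
  apply: near_eq_differentiable; apply: filterS near_i => _ [w [iw _] <-].
  by rewrite /H !(slit_locE sA) // mxE.
have dV a b : differentiable (fun z => V z a b : R^o) (cmap (sl i) u).
  have := differentiable_entry 0 b (differentiable_Kcoord (0, delta_mx 0 a) iu).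
  apply: near_eq_differentiable; apply: filterS near_i => _ [w [iw _] <-].
  by rewrite /V !(slit_locE sA) // mxE.
have uV : \forall z \near cmap (sl i) u, V z \in unitmx.
  apply: filterS near_i => _ [w [iw _] <-].
  by rewrite /V (slit_locE sA) // Kvert_unit.
have := differentiable_pair dY (differentiable_mulmx_row
  (differentiableN (differentiable_mulmx_row dY dH)) (differentiable_invmx uV dV)).
apply: near_eq_differentiable; apply: filterS near_i => _ [w [iw _] <-].
by rewrite /H /V /= !fctE !(slit_locE sA) // betaE.
Qed.

End Connection.

(** * The vertical bracket *)

Section Torsion.
Context {R : realType} {n : nat} {M : Type} {A : atlas M 'rV[R]_n}.
Local Notation E := 'rV[R]_n.
Hypothesis sA : smooth_atlas A.
Hypothesis chartsA : forall p, exists i : chart A, cdom i p.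
Implicit Types (i j k : chart A) (u w : slit A).
Local Notation Tslit u := (tangent (slit_atlas A) u).
Local Notation pi_fiber u := (tangent A (foot u)).
Local Notation sl i := (i : chart (slit_atlas A)).
Let sS := smooth_atlas_slit sA.

Lemma near_line (V : normedModType R) (U : set V) (x v : V) :
  open U -> U x -> \forall t \near (0 : R), U (t *: v + x).
Proof.
move=> oU Ux; have c : {for (0 : R), continuous (fun t : R => t *: v + x)}.
  apply: continuousD; last exact: cst_continuous.
  exact: scalel_continuous.
by apply: c; rewrite scale0r add0r; exact: open_nbhs_nbhs.
Qed.

Lemma diff_lincomb (V W : normedModType R) (f g : V -> W) (t : R) x v :
  differentiable f x -> differentiable g x ->
  'd (fun y => t *: f y + g y) x v = t *: 'd f x v + 'd g x v.
Proof.
move=> df dg; have dt := differentiableZ t df.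
apply: etrans (congr1 (@^~ v) (diffD dt dg)) _.
exact: (congr1 (fun l : V -> W => l v + 'd g x v) (diffZ t df)).
Qed.

(* The mixed second derivatives of the transition map (x, y) |-> (f x, df_x y)
   commute as soon as one direction is vertical, without Schwarz's theorem: along
   a vertical line its differential is affine. *)
Lemma slit_transition_vertical_comm i j u (x : E) (e : E * E) :
  cdom i (foot u) -> cdom j (foot u) ->
  'd (fun z => 'd (loc (sl i) (cmap (sl j))) z e) (cmap (sl i) u) (0, x) =
  'd (fun z => 'd (loc (sl i) (cmap (sl j))) z (0, x)) (cmap (sl i) u) e.
Proof.
move=> iu ju; have [_ oA smA] := sA; have [_ oS smS] := sS.
pose S := cmap (sl i) @` (cdom (sl i) `&` cdom (sl j)).
have Su : S (cmap (sl i) u) by exists u.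
pose phi : E -> E := loc i (cmap j).
have Uu : (cmap i @` (cdom i `&` cdom j)) (cmap i (foot u)) by exists (foot u).
have dphi y : differentiable (fun x' => 'd phi x' y : E) (cmap i (foot u)).
  exact: (Ck_differentiable_diff y (oA i j) Uu (smA i j 2%N)).
(* Both sides equal [(0, r)], where [r] is the second derivative of [phi], first along [x] and then
   along the base component of [e]. *)
pose r : E := 'd (fun x' => 'd phi x' x : E) (cmap i (foot u)) e.1.
transitivity ((0, r) : E * E).
  rewrite -deriveE; last exact: (Ck_differentiable_diff e (oS i j) Su (smS i j 2%N)).
  apply: derive_affine; apply: filterS (near_line (0, x) (oS i j) Su) => t [w [iw jw] wE].
  have w1 : cmap i (foot w) = cmap i (foot u).
    by have := congr1 fst wE; rewrite /= scaler0 add0r.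
  have w2 : fib w i = t *: x + fib u i by exact: (congr1 snd wE).
  apply: etrans (_ : 'd (loc (sl i) (cmap (sl j))) (cmap (sl i) w) e = _).
    by rewrite wE.
  apply: etrans (diff_slit_transition sA e iw jw) _.
  apply: esym; apply: etrans (congr1 (+%R^~ (t *: (0, r)))
    (diff_slit_transition sA e iu ju)) _.
  move: (cmap i (foot w)) (fib w i) w1 w2 => p1 p2 -> ->.
  apply: (f_equal2 pair).
    apply: etrans (addr0 _); apply: (congr1 (+%R _)); exact: scaler0.
  have aux (a b c d : E) : a = c + b -> b + d + c = a + d.
    by move=> ->; rewrite addrAC [b + c]addrC.
  apply: aux; apply: etrans (_ : 'd (fun x' => t *: ('d phi x' x : E) + 'd phi x' (fib u i) : E)
    (cmap i (foot u)) e.1 = _); last exact: diff_lincomb (dphi _) (dphi _).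
  apply: (congr1 (fun f : E -> E => 'd f (cmap i (foot u)) e.1)).
  by apply/funext => x'; exact: linearP.
pose G1 (z : E * E) : E * E := 'd (loc (sl i) (cmap (sl j))) z (0, x).
pose G2 (z : E * E) : E * E := (0, 'd phi (z.1 : E) x).
have E1 : 'd G1 (cmap (sl i) u) e = 'd G2 (cmap (sl i) u) e.
  apply: (congr1 (@^~ e)); apply: near_eq_diff.
  apply: filterS (near_overlap sS (iu : cdom (sl i) u) (ju : cdom (sl j) u)) => _ [w [iw jw] <-].
  exact: diff_slit_transition_vertical.
have [d1 _] := diff_fst (cmap (sl i) u) e.
have d2 : differentiable (fun z : E * E => 'd phi (z.1 : E) x : E) (cmap (sl i) u).
  exact: (differentiable_comp d1 (dphi x)).
have E2 : 'd G2 (cmap (sl i) u) e = (0, r).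
  apply: etrans (congr1 (@^~ e) (diff_pair (differentiable_cst (0 : E) _) d2)) _.
  apply: (f_equal2 pair); first exact: (congr1 (@^~ e) (diff_cst _ _)).
  exact: (@diff_comp_fst _ _ _ _ (fun x' => 'd phi x' x : E) (cmap (sl i) u) e (dphi x)).
exact: esym (etrans E1 E2).
Qed.

Lemma diff_component1 (V W Z : normedModType R) (f : Z -> V * W) (g : Z -> V) z v :
  differentiable f z -> (\near z, (f z).1 = g z) -> ('d f z v).1 = 'd g z v.
Proof.
move=> df fg; have [d1 d1E] := diff_fst (f z) ('d f z v).
rewrite -d1E -[LHS](congr1 (@^~ v) (diff_comp df d1)).
by apply: (congr1 (@^~ v)); apply: near_eq_diff.
Qed.

(** The first components of the two fields are 0 and [Y]. The first component of the bracket is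
    therefore the derivative of [Y] along the vertical vector, minus the derivative of 0; the fibre
    component of [beta D (Y w)] contributes nothing, whence a right-hand side free of [D]. *)
Lemma rho_bracket (D : pi_derivation A) i u (X Y : pi_field A) :
  regular_connection D -> some_chart (slit_atlas A) u = Some i ->
  smooth_pi_near X u -> smooth_pi_near Y u ->
  rho (lie_bracket (fun w => gamma (X w)) (fun w => beta D (Y w)) u) i =
  'd (loc (sl i) (fun w => Y w i)) (cmap (sl i) u) (0, X u i).
Proof.
move=> regD iE sX sY; have iu : cdom i (foot u) := some_chartP iE.
have fE := finite_dim_pair (@finite_dim_rV R n) (@finite_dim_rV R n).
have near_i := near_overlap sS (iu : cdom (sl i) u) (iu : cdom (sl i) u).
have dY := differentiable_beta sA chartsA regD iu sY.
have dX' := @smooth_near_differentiable _ _ _ (slit_atlas A) _ _ i u (sX i iu) iu.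
have dX : differentiable (loc (sl i) (fun w => gamma (X w) i)) (cmap (sl i) u).
  have := differentiable_pair (differentiable_cst (0 : E) _) dX'.
  apply: near_eq_differentiable; apply: filterS near_i => _ [w [iw _] <-].
  by rewrite !(slit_locE sA) // (gammaE sA).
have comm j : cdom (sl j) u ->
    'd (fun z => 'd (loc (sl i) (cmap (sl j))) z (beta D (Y u) i)) (cmap (sl i) u)
      (gamma (X u) i) =
    'd (fun z => 'd (loc (sl i) (cmap (sl j))) z (gamma (X u) i)) (cmap (sl i) u)
      (beta D (Y u) i).
  by move=> ju; rewrite (gammaE sA); exact: slit_transition_vertical_comm.
have E1 : ('d (loc (sl i) (fun w => beta D (Y w) i)) (cmap (sl i) u) (gamma (X u) i)).1 =
    'd (loc (sl i) (fun w => Y w i)) (cmap (sl i) u) (gamma (X u) i).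
  apply: (diff_component1 (gamma (X u) i) dY).
  apply: filterS near_i => _ [w [iw _] <-].
  by rewrite !(slit_locE sA) // (betaE sA chartsA regD).
have E2 : ('d (loc (sl i) (fun w => gamma (X w) i)) (cmap (sl i) u) (beta D (Y u) i)).1 = 0.
  apply: etrans (diff_component1 (g := cst (0 : E)) (beta D (Y u) i) dX _) _.
    apply: filterS near_i => _ [w [iw _] <-].
    by rewrite (slit_locE sA) // (gammaE sA).
  exact: (congr1 (@^~ _) (diff_cst _ _)).
rewrite -(gammaE sA) (rhoE sA) //.
apply: etrans (congr1 fst (lie_bracketE sS fE iE dX dY comm)) _.
exact: etrans (f_equal2 (fun a b : E => a - b) E1 E2) (subr0 _).
Qed.

Lemma slit_some_chart u :
  exists i, some_chart (slit_atlas A) u = Some (sl i) /\ cdom i (foot u).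
Proof.
have [i0 iu0] := chartsA (foot u).
have [i iE] := some_chart_exists (iu0 : cdom (sl i0) u).
by exists i; split=> //; exact: some_chartP iE.
Qed.

Lemma mixed_torsion_difference (D D' : pi_derivation A) u (X Y : pi_field A) :
  regular_connection D -> regular_connection D' ->
  smooth_pi_near X u -> smooth_pi_near Y u ->
  mixed_torsion D' X Y u - mixed_torsion D X Y u =
  D' u (gamma (X u)) Y - D u (gamma (X u)) Y.
Proof.
move=> rD rD' sX sY; rewrite !(mixed_torsionE sA chartsA) //.
have [i [iE iu]] := slit_some_chart u.
have bE : rho (lie_bracket (fun w => gamma (X w)) (fun w => beta D' (Y w)) u) =
    rho (lie_bracket (fun w => gamma (X w)) (fun w => beta D (Y w)) u).
  apply: (tangent_ext iu).
  exact: etrans (rho_bracket rD' iE sX sY) (esym (rho_bracket rD iE sX sY)).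
have subBB (V : zmodType) (a b c c' : V) : c' = c -> (a - c') - (b - c) = a - b.
  by move=> ->; rewrite opprB addrA subrK.
exact: subBB bE.
Qed.

End Torsion.

(** * The Finsler metric *)

Lemma derive1_line (R : realType) (V W : normedModType R) (f : V -> W) (g : R -> W)
    (x v : V) :
  (\forall t \near (0 : R), g t = f (t *: v + x)) -> derive1 g 0 = 'D_v f x.
Proof.
move=> gf; pose h (t : R) := f (t *: v + x).
rewrite derive1E (near_eq_derive (g := h)) //.
apply: (congr1 (fun k : R -> W => lim (k @ 0^'))).
apply/funext => t; rewrite /h /=.
by rewrite scale0r add0r [t *: _]mulr1 addr0.
Qed.

Section Finsler.
Context {R : realType} {n : nat} {M : Type} {A : atlas M 'rV[R]_n}.
Local Notation E := 'rV[R]_n.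
Hypothesis sA : smooth_atlas A.
Hypothesis chartsA : forall p, exists i : chart A, cdom i p.
Implicit Types (i j k : chart A) (u w : slit A).
Local Notation Tslit u := (tangent (slit_atlas A) u).
Local Notation pi_fiber u := (tangent A (foot u)).
Local Notation sl i := (i : chart (slit_atlas A)).
Let sS := smooth_atlas_slit sA.
Variable L : forall p, tangent A p -> R.
Hypothesis smL : smooth (slit_atlas A) (fun u => L (fib u) : R^o).

Let F i : E * E -> R^o := loc (sl i) (fun u => L (fib u) ^+ 2 : R^o).

Lemma F_chart i p (T : tangent A p) : cdom i p -> T != 0 ->
  F i (cmap i p, T i) = L T ^+ 2.
Proof.
move=> ip T0; rewrite -[(_, _)]/(cmap (sl i) (Slit T0)) /F.
by rewrite (slit_locE sA).
Qed.

Lemma F_smooth i u : cdom i (foot u) -> exists U : set (E * E),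
  [/\ open U, U (cmap (sl i) u), forall z, U z -> z.2 != 0 & forall m, Ck m (F i) U].
Proof.
move=> iu; have [U [oU Uu Ui smU]] := smL (iu : cdom (sl i) u).
exists U; split=> // [z /Ui [w iw <-]|m]; first exact: fib_coord_neq0.
apply: Ck_ext (Ck_scale oU (smU m) (smU m)) => // z /Ui [w iw <-].
by rewrite /F !(slit_locE sA) // expr2.
Qed.

(** [F i] represents L^2 only at nonzero vectors, while the lines in the definition of the metric
    may cross the zero vector. Only small parameters matter for derivatives at 0, and for these the
    lines stay in the open set where the fibre component is nonzero. *)
Lemma finsler_metricE i u (v w : pi_fiber u) : cdom i (foot u) ->
  finsler_metric L v w =
  2^-1 * ('D_(0, v i) (fun z => 'D_(0, w i) (F i) z) (cmap (sl i) u) : R^o).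
Proof.
move=> iu; apply: (congr1 ( *%R 2^-1)).
have oN : open [set z : E * E | setT z.1 /\ z.2 != 0] by apply: open_slit; exact: openT.
have T0 (T : pi_fiber u) : T i != 0 -> T != 0.
  by apply: contra_neq => ->; rewrite tangent0.
have Nu : [set z : E * E | setT z.1 /\ z.2 != 0] (cmap (sl i) u).
  by split=> //; exact: fib_coord_neq0.
apply: derive1_line; apply: filterS (near_line (0, v i) oN Nu) => s Ns.
apply: derive1_line; apply: filterS (near_line (0, w i) oN Ns) => t [_ Nt].
have -> : t *: (0, w i) + (s *: (0, v i) + cmap (sl i) u) =
    (cmap i (foot u), (fib u + s *: v + t *: w) i) :> E * E.
  by rewrite !pair_scaleE !pair_addE !scaler0 !add0r addrC [s *: _ + _]addrC.
rewrite F_chart //; apply: T0; apply: contra_neq Nt => <- /=.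
by rewrite addrC [s *: _ + _]addrC.
Qed.

Lemma finsler_metric_addl u (v v' w : pi_fiber u) :
  finsler_metric L (v + v') w = finsler_metric L v w + finsler_metric L v' w.
Proof.
have [i iu] := chartsA (foot u); have [U [oU Uu _ cF]] := F_smooth iu.
have dG : differentiable (fun z => 'D_(0, w i) (F i) z) (cmap (sl i) u).
  by have [_ /(_ (0, w i)) [+ _]] := cF 2%N; apply.
rewrite !(finsler_metricE _ _ iu) -mulrDr; congr (_ * _).
rewrite !(deriveE _ dG) -raddfD; apply: (congr1 ('d _ _)).
by rewrite pair_addE addr0.
Qed.

(** The second argument is the direction of the inner derivative, so additivity has to hold at all
    points near [u] before the outer derivative is taken. *)
Lemma finsler_metric_addr u (v w w' : pi_fiber u) :
  finsler_metric L v (w + w') = finsler_metric L v w + finsler_metric L v w'.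
Proof.
have [i iu] := chartsA (foot u); have [U [oU Uu _ cF]] := F_smooth iu.
have dF z : U z -> differentiable (F i) z by have [+ _] := cF 1%N; apply.
have dG x : derivable (fun z => 'D_(0, x) (F i) z) (cmap (sl i) u) (0, v i).
  by apply: diff_derivable; have [_ /(_ (0, x)) [+ _]] := cF 2%N; apply.
rewrite !(finsler_metricE _ _ iu) -mulrDr; congr (_ * _).
rewrite -deriveD //; apply: near_eq_derive.
apply: filterS (open_nbhs_nbhs (conj oU Uu)) => z Uz /=.
rewrite !fctE !deriveE; try exact: dF; rewrite -raddfD; apply: (congr1 ('d _ _)).
by rewrite pair_addE addr0.
Qed.

Lemma finsler_metric_subl u (v v' w : pi_fiber u) :
  finsler_metric L (v - v') w = finsler_metric L v w - finsler_metric L v' w.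
Proof. by apply/eqP; rewrite eq_sym subr_eq -finsler_metric_addl subrK. Qed.

Lemma finsler_metric_subr u (v w w' : pi_fiber u) :
  finsler_metric L v (w - w') = finsler_metric L v w - finsler_metric L v w'.
Proof. by apply/eqP; rewrite eq_sym subr_eq -finsler_metric_addr subrK. Qed.

End Finsler.

(** * Conformal change *)

Section Conformal.
Context {R : realType} {n : nat} {M : Type} {A : atlas M 'rV[R]_n}.
Local Notation E := 'rV[R]_n.
Hypothesis sA : smooth_atlas A.
Hypothesis chartsA : forall p, exists i : chart A, cdom i p.
Implicit Types (i j k : chart A) (u w : slit A).
Local Notation Tslit u := (tangent (slit_atlas A) u).
Local Notation pi_fiber u := (tangent A (foot u)).
Local Notation sl i := (i : chart (slit_atlas A)).
Let sS := smooth_atlas_slit sA.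

(* No differentiability of h is needed: the library's differential of a
   non-differentiable map is 0, and h is differentiable iff c h is. *)
Lemma tder_vertical_scale u (v : pi_fiber u) (c : M -> R^o) (h : slit A -> R^o) :
  smooth A c -> (forall p, c p != 0 :> R) ->
  tder (gamma v) (fun w => (c (foot w) : R) *: h w) =
  (c (foot u) : R) *: tder (gamma v) h.
Proof.
move=> sc c0; have [i [iE iu]] := slit_some_chart chartsA u.
have tderE f : tder (gamma v) f = 'd (loc (sl i) f) (cmap (sl i) u) (gamma v i) :> R^o.
  by rewrite /tder iE.
rewrite !tderE (gammaE sA); set z := cmap (sl i) u.
have near_i := near_overlap sS (iu : cdom (sl i) u) (iu : cdom (sl i) u).
have dc : differentiable (loc i c) (cmap i (foot u)).
  exact: (@smooth_near_differentiable _ _ _ A _ c i _ (sc _) iu).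
pose C (z : E * E) : R^o := loc i c z.1.
have [d1 _] := diff_fst z (0, v i).
have dC : differentiable C z by exact: (differentiable_comp d1 dc).
have dCv : 'd C z (0, v i) = 0.
  by apply: etrans (@diff_comp_fst _ _ _ _ (loc i c) z (0, v i) dc) _; exact: linear0.
have Cz : C z = c (foot u) by rewrite /C /z /= (locE sA).
have Cz0 : (C z : R) != 0 by rewrite Cz.
have prodE : \near z, (C z : R) *: loc (sl i) h z =
    loc (sl i) (fun w => (c (foot w) : R) *: h w) z.
  apply: filterS near_i => _ [w [iw _] <-].
  by rewrite /C /= !(slit_locE sA) // (locE sA).
have [dh|ndh] := pselect (differentiable (loc (sl i) h) z).
  have [_ dCh] := differentiable_scale dC dh.
  apply: etrans (esym (congr1 (@^~ _) (near_eq_diff prodE))) _.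
  have aux (a a' d : R) (b e : R^o) : a = a' -> d = 0 -> a *: b + d *: e = a' *: b.
    by move=> -> ->; rewrite scale0r addr0.
  exact: etrans (dCh _) (aux _ _ _ _ _ Cz dCv).
have dh0 : 'd (loc (sl i) h) z (0, v i) = 0.
  exact: (congr1 (@^~ _) (diff_not_differentiable ndh)).
apply: esym; apply: etrans (congr1 ( *:%R (c (foot u) : R)) dh0) _.
apply: etrans (scaler0 _ _) _; apply: esym.
apply: (congr1 (@^~ (0, v i)) (diff_not_differentiable _)) => dp; apply: ndh.
have dCi : differentiable (fun z => (C z : R)^-1 : R^o) z by exact: differentiableV.
have [+ _] := differentiable_scale dCi dp.
apply: near_eq_differentiable; apply: filterS near_i => _ [w [iw _] <-].
rewrite /C /= !(slit_locE sA) // (locE sA) // scalerA mulVf ?scale1r //.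
Qed.

(** * Cartan connections of two proportional metrics *)

Section Compare.
Variables (L L' : forall p, tangent A p -> R) (D D' : pi_derivation A).
Variable c : M -> R^o.
Hypotheses (hL : finsler L) (hD : cartan_connection L D) (hD' : cartan_connection L' D').
Hypotheses (sc : smooth A c) (c0 : forall p, c p != 0 :> R).
Hypothesis LL' : forall u (v w : pi_fiber u),
  finsler_metric L' v w = (c (foot u) : R) * finsler_metric L v w.

Lemma mixed_torsion_conformal u (X Y : pi_field A) :
  smooth_pi_near X u -> smooth_pi_near Y u ->
  mixed_torsion D' X Y u = mixed_torsion D X Y u.
Proof.
move=> sX sY; have [smL [_ [_ posL]]] := hL.
have [rD [compD [_ symD]]] := hD; have [rD' [compD' [_ symD']]] := hD'.
pose g := fun v w : pi_fiber u => finsler_metric L v w.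
pose phi (Z : pi_field A) := D' (gamma (X u)) Z - D (gamma (X u)) Z.
have phiE (Z : pi_field A) : smooth_pi_near Z u ->
    mixed_torsion D' X Z u - mixed_torsion D X Z u = phi Z.
  by move=> sZ; exact: mixed_torsion_difference.
have subl := finsler_metric_subl sA chartsA smL.
have subr := finsler_metric_subr sA chartsA smL.
have anti (Z T : pi_field A) : smooth_pi_near Z u -> smooth_pi_near T u ->
    g (phi Z) (T u) + g (Z u) (phi T) = 0.
  move=> sZ sT.
  (* Here [k] is the value of [c], [r] the vertical derivative of g(Z, T), and [a], [b] and [a'],
     [b'] are the two terms of metric compatibility for [D'] and for [D]. Since [c] is constant
     along fibres it factors out of the compatibility of [D'] and can be cancelled. *)
  have cancel_c (k a b a' b' r : R) : k != 0 -> k * a + k * b = k * r ->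
      r = a' + b' -> (a - a') + (b - b') = 0.
    move=> k0; rewrite -mulrDr => /(mulfI k0) e1 e2.
    by rewrite addrACA -opprD e1 e2 subrr.
  have E0 : tder (gamma (X u)) (fun w => finsler_metric L' (Z w) (T w) : R^o) =
      tder (gamma (X u)) (fun w => (c (foot w) : R) *: (finsler_metric L (Z w) (T w) : R^o)).
    by apply: congr1; apply/funext => w; exact: LL'.
  have E1 := tder_vertical_scale (X u) (fun w => finsler_metric L (Z w) (T w) : R^o) sc c0.
  have E2 := f_equal2 +%R (LL' (D' (gamma (X u)) Z) (T u)) (LL' (Z u) (D' (gamma (X u)) T)).
  apply: etrans (f_equal2 +%R (subl _ _ _ _) (subr _ _ _ _)) _.
  exact: cancel_c (c0 _) (etrans (esym E2) (etrans (esym (compD' _ _ _ _ sZ sT))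
    (etrans E0 E1))) (compD _ _ _ _ sZ sT).
have sym (Z T : pi_field A) : smooth_pi_near Z u -> smooth_pi_near T u ->
    g (phi Z) (T u) = g (phi T) (Z u).
  move=> sZ sT; have cancel_c (k a b a' b' : R) : k != 0 -> k * a = k * b -> a' = b' ->
      a - a' = b - b'.
    by move=> k0 /(mulfI k0) -> ->.
  rewrite -(phiE Z sZ) -(phiE T sT).
  apply: etrans (subl _ _ _ _) _; apply: etrans _ (esym (subl _ _ _ _)).
  exact: cancel_c (c0 _) (etrans (esym (LL' _ _)) (etrans (symD' u X Z T sX sZ sT) (LL' _ _)))
    (symD u X Z T sX sZ sT).
have [i iu] := chartsA (foot u).
(* [phi Y] is a vector at [u] alone; [Z] extends it to a section smooth near [u], to which the
   axioms apply. *)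
pose Z : pi_field A := fun w => coord_vector i (phi Y i) (foot w).
have sZ : smooth_pi_near Z u by exact: smooth_pi_coord.
have Zu : Z u = phi Y by exact: (coord_vector_tangent sA).
have phi0 : g (phi Y) (phi Y) = 0.
  (* Symmetry is applied to the first term g(phi Z, Y) of the skewness identity, turning it into
     g(phi Y, Z), that is, a second copy of g(phi Y, phi Y). *)
  have := anti Z Y sZ sY; rewrite -(sym _ _ sY sZ) Zu => /eqP.
  by rewrite -mulr2n mulrn_eq0 /= => /eqP.
apply: subr0_eq; rewrite phiE //; apply/eqP/contraT => /posL.
by rewrite -[finsler_metric _ _ _]/(g _ _) phi0 ltxx.
Qed.

(** The trace feeds coordinate fields of a chart around [u] to the torsion; these are smooth near
    [u], so the equality of the torsions applies term by term. *)
Lemma contracted_torsion_conformal u (X : pi_field A) : smooth_pi_near X u ->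
  contracted_torsion D' X u = contracted_torsion D X u.
Proof.
move=> sX; rewrite /contracted_torsion /pi_trace.
case iE : (some_chart A (foot u)) => [i|]; last by [].
apply: eq_bigr => k _; apply: (congr1 (fun v : pi_fiber u => v i 0 k)).
apply: mixed_torsion_conformal => //.
exact: (smooth_pi_coord sA _ (some_chartP iE)).
Qed.

(** One implication for a general factor [c]; exchanging the two metrics replaces [c] by its
    inverse, so this also yields the converse. *)
Lemma quasi_C_reducible_conformal : quasi_C_reducible L D -> quasi_C_reducible L' D'.
Proof.
move=> [n3 [B [[Blin [Bsym Bsm]] Bind BT]]]; split=> //.
exists (fun u x y => (c (foot u) : R) * B u x y); split.
- split; first by move=> u a x x' y; rewrite Blin mulrDr mulrCA.
  split; first by move=> u x y; rewrite Bsym.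
  move=> u X Y sX sY; apply: smooth_near_slit => i iu.
  have [U [oU Uu Ui smU]] := Bsm u X Y sX sY i iu.
  have [U' [oU' Uu' Ui' smU']] := smooth_near_foot sA (@sc (foot u)) (iu : cdom (sl i) u).
  exists (U `&` U'); split; [exact: openI|by split|by move=> z [/Ui]|move=> m].
  have oUU := openI oU oU'.
  apply: Ck_ext (Ck_scale oUU (Ck_sub (@subIsetr _ _ _) (smU' m))
    (Ck_sub (@subIsetl _ _ _) (smU m))) => // z [/Ui [w iw <-] _].
  by rewrite !(slit_locE sA).
- by move=> u v; rewrite Bind mulr0.
move=> u X Y Z sX sY sZ.
have e := congr1 (fun x => finsler_metric L x (Z u)) (mixed_torsion_conformal sX sY).
apply: etrans (LL' _ _) _.
apply: etrans (congr1 ( *%R (c (foot u) : R)) (etrans e (BT u X Y Z sX sY sZ))) _.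
have distr (k b1 b2 b3 c1 c2 c3 c1' c2' c3' : R) : c1' = c1 -> c2' = c2 -> c3' = c3 ->
    k * (b1 * c1 + b2 * c2 + b3 * c3) = k * b1 * c1' + k * b2 * c2' + k * b3 * c3'.
  by move=> -> -> ->; rewrite !mulrDr !mulrA.
exact: distr (contracted_torsion_conformal sZ) (contracted_torsion_conformal sX)
  (contracted_torsion_conformal sY).
Qed.

End Compare.

Lemma smooth_expR (f : M -> R^o) (a : R) :
  smooth A f -> smooth A (fun p => expR (a * f p) : R^o).
Proof.
move=> sf p i ip; have [U [oU Up Ui smU]] := sf p i ip.
exists U; split=> // m.
have ca : Ck m (fun x => (a : R) *: (loc i f x : R^o)) U.
  by have := Ck_scale oU (Ck_cst m (a : R^o) U) (smU m).
have := Ck_comp (@finite_dim_real R) oU _ (Ck_expR m openT) ca.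
move=> /(_ (fun _ _ => I)); apply: Ck_ext => // x /Ui [q iq <-].
by rewrite !(locE sA).
Qed.

End Conformal.

(** * From the manifold axioms to the equivalence *)

Lemma manifold_smooth_atlas (R : realType) (n : nat) (M : topologicalType)
    (A : atlas M 'rV[R]_n) : manifold A -> smooth_atlas A.
Proof.
move=> [_ [_ [_ [chA smA]]]]; split=> // [i p q ip iq|i j].
  by have [_ inj _ _] := chA i; apply: inj; rewrite inE.
have [oi _ _ oimg] := chA i; have [oj _ _ _] := chA j.
by apply: oimg; [exact: openI|exact: subIsetl].
Qed.

Theorem proposition3p23 (R : realType) (n : nat) (M : topologicalType)
    (A : atlas M 'rV[R]_n) (hM : manifold A)
    (L L' : forall p : M, tangent A p -> R)
    (hL : finsler L) (hL' : finsler L')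
    (nabla nabla' : pi_derivation A)
    (hnabla : cartan_connection L nabla)
    (hnabla' : cartan_connection L' nabla')
    (hconf : conformally_related L L') :
  quasi_C_reducible L nabla <-> quasi_C_reducible L' nabla'.
Proof.
have sA := manifold_smooth_atlas hM; have [_ [_ [chartsA _]]] := hM.
have [sigma [ssigma _ LL']] := hconf.
have expR_neq0 (a : R) p : expR (a * sigma p) != 0 by rewrite gt_eqF ?expR_gt0.
split.
  exact: (quasi_C_reducible_conformal sA chartsA hL hnabla hnabla'
    (smooth_expR sA 2 ssigma) (expR_neq0 2) LL').
(* The roles are exchanged: g is g' multiplied by e^(-2 sigma). *)
apply: (quasi_C_reducible_conformal sA chartsA hL' hnabla' hnabla
  (smooth_expR sA (- 2) ssigma) (expR_neq0 (- 2))) => u v w.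
by rewrite LL' mulrA -expRD -mulrDl addNr mul0r expR0 mul1r.
Qed.
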